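(* Let $\mathcal{U}$ be a non-principal ultrafilter on $\mathbb{N}$. If $A$ is a C*-algebra with infinitely many extremal tracial states, then there is a trace on the ultrapower $A^{\mathcal{U}}$ that is not a $\mathcal{U}$-limit of traces on $A$.
   Context: For a C*-algebra $A$, $l^\infty(A)$ is the C*-algebra of norm-bounded sequences in $A$ with pointwise operations, $c_{\mathcal{U}}(A)=\{(a_n)\in l^\infty(A):\lim_{n\to\mathcal{U}}\|a_n\|=0\}$ is a closed two-sided ideal in it, and $A^{\mathcal{U}}=l^\infty(A)/c_{\mathcal{U}}(A)$. The class of $(a_n)$ is written $(a_n)^{\mathcal{U}}$. A trace on a C*-algebra is a bounded positive linear functional $\tau$ with $\tau(ab)=\tau(ba)$ for all $a,b$; a tracial state is a trace of norm $1$; a tracial state is extremal if it is an extreme point of the convex set of tracial states. The $\mathcal{U}$-limit of a norm-bounded sequence $(\tau_n)$ of traces on $A$ is the trace on $A^{\mathcal{U}}$ given by $(a_n)^{\mathcal{U}}\mapsto\lim_{n\to\mathcal{U}}\tau_n(a_n)$. *)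

(* Defs.v *)
From HB Require Import structures.
From mathcomp Require Import all_boot all_order all_algebra.
From mathcomp Require Import ring_quotient complex.
From mathcomp Require Import all_classical all_reals all_analysis.

Set Implicit Arguments.
Unset Strict Implicit.
Unset Printing Implicit Defensive.
Import Order.TTheory GRing.Theory Num.Theory numFieldNormedType.Exports.

Local Open Scope classical_set_scope.
Local Open Scope ring_scope.
Local Open Scope complex_scope.

HB.instance Definition _ (R : realType) := NormedModule.copy R[i] R[i]^o.

(* A normed module over R[i] has its norm in R[i]; rnorm is the same number in R. *)
Definition rnorm (R : realType) (V : normedModType R[i]) (x : V) : R :=
  complex.Re `|x|.

Section RNorm.
Variables (R : realType) (V : normedModType R[i]).
Implicit Types x y : V.

Lemma rnormE x : `|x| = (rnorm x)%:C.
Proof. by rewrite /rnorm RRe_real // normr_real. Qed.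

Lemma rnorm_ge0 x : 0 <= rnorm x.
Proof. by rewrite -ler0c -rnormE. Qed.

Lemma rnorm_le x (M : R) : (`|x| <= M%:C) = (rnorm x <= M).
Proof. by rewrite rnormE lecR. Qed.

Lemma rnorm0 : rnorm (0 : V) = 0.
Proof. by rewrite /rnorm normr0. Qed.

Lemma rnorm0_eq0 x : rnorm x = 0 -> x = 0.
Proof. by move=> x0; apply/eqP; rewrite -normr_eq0 rnormE x0. Qed.

Lemma rnormD x y : rnorm (x + y) <= rnorm x + rnorm y.
Proof. by rewrite -lecR rmorphD/= -!rnormE ler_normD. Qed.

Lemma rnormN x : rnorm (- x) = rnorm x.
Proof. by rewrite /rnorm normrN. Qed.

Lemma rnormBC x y : rnorm (x - y) = rnorm (y - x).
Proof. by rewrite -rnormN opprB. Qed.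

Lemma rnormZ (k : R[i]) x : rnorm (k *: x) = rnorm k * rnorm x.
Proof. by apply: complexI; rewrite rmorphM/= -!rnormE normrZ. Qed.

End RNorm.

(* Not assumed unital, hence not built on a MathComp ring structure. *)
HB.mixin Record CompleteNormedModule_isCStarAlgebra (R : realType) A
    & CompleteNormedModule R[i] A := {
  cmul : A -> A -> A;
  star : A -> A;
  cmulA : associative cmul;
  cmulDl : left_distributive cmul +%R;
  cmulDr : right_distributive cmul +%R;
  cscaleAl : forall (k : R[i]) a b, k *: cmul a b = cmul (k *: a) b;
  cscaleAr : forall (k : R[i]) a b, k *: cmul a b = cmul a (k *: b);
  starK : involutive star;
  starD : {morph star : a b / a + b};
  starZ : forall (k : R[i]) a, star (k *: a) = k^* *: star a;
  starM : forall a b, star (cmul a b) = cmul (star b) (star a);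
  cnormM : forall a b, `|cmul a b| <= `|a| * `|b|;
  cnorm_star : forall a, `|cmul (star a) a| = `|a| ^+ 2
}.

#[short(type="cstarAlgType")]
HB.structure Definition CStarAlgebra (R : realType) :=
  {A of CompleteNormedModule_isCStarAlgebra R A & CompleteNormedModule R[i] A}.

Notation "a ** b" := (cmul a b) (at level 40, left associativity) : ring_scope.

Section CStarTheory.
Variables (R : realType) (A : cstarAlgType R).
Implicit Types a b : A.

Lemma cmul0r a : 0 ** a = 0.
Proof. by apply: (addrI (0 ** a)); rewrite -cmulDl !addr0. Qed.

Lemma cmulr0 a : a ** 0 = 0.
Proof. by apply: (addrI (a ** 0)); rewrite -cmulDr !addr0. Qed.

Lemma cmulNr a b : (- a) ** b = - (a ** b).
Proof. by apply/eqP; rewrite -addr_eq0 -cmulDl addNr cmul0r. Qed.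

Lemma cmulrN a b : a ** (- b) = - (a ** b).
Proof. by apply/eqP; rewrite -addr_eq0 -cmulDr addNr cmulr0. Qed.

Lemma star0 : star (0 : A) = 0.
Proof. by apply: (addrI (star (0 : A))); rewrite -starD !addr0. Qed.

Lemma starN a : star (- a) = - star a.
Proof. by apply/eqP; rewrite -addr_eq0 -starD addNr star0. Qed.

Lemma rnormM a b : rnorm (a ** b) <= rnorm a * rnorm b.
Proof. by rewrite -lecR rmorphM/= -!rnormE cnormM. Qed.

Lemma rnorm_star2 a : rnorm (star a ** a) = rnorm a ^+ 2.
Proof. by apply: complexI; rewrite rmorphXn/= -!rnormE cnorm_star. Qed.

Lemma rnorm_star a : rnorm (star a) = rnorm a.
Proof.
suff le b : rnorm b <= rnorm (star b).
  by apply/eqP; rewrite eq_le le andbT -{2}[a]starK le.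
have [b0|b0] := leP (rnorm b) 0; first exact: le_trans b0 (rnorm_ge0 _).
by rewrite -(ler_pM2r b0) -expr2 -rnorm_star2 rnormM.
Qed.

End CStarTheory.

Section Traces.
Variables (R : realType) (A : cstarAlgType R).
Implicit Types tau : A -> R[i].

Definition bounded_functional tau :=
  exists M : R, forall a, rnorm (tau a) <= M * rnorm a.

Definition functional_norm tau : R :=
  sup [set rnorm (tau a) | a in [set a : A | rnorm a <= 1]].

(* The positive elements of A are the star a ** a; in R[i], 0 <= z means that
   z is real and nonnegative. *)
Definition positive_functional tau := forall a : A, 0 <= tau (star a ** a).

Record is_trace tau : Prop := {
  trace_linear : scalar tau;
  trace_bounded : bounded_functional tau;
  trace_positive : positive_functional tau;
  trace_comm : forall a b : A, tau (a ** b) = tau (b ** a)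
}.

Definition tracial_state tau := is_trace tau /\ functional_norm tau = 1.

Definition extreme_point (S : set (A -> R[i])) tau :=
  S tau /\
  forall (tau1 tau2 : A -> R[i]) (t : R), S tau1 -> S tau2 -> 0 < t < 1 ->
    tau = (fun a => t%:C * tau1 a + (1 - t)%:C * tau2 a) ->
    tau1 = tau /\ tau2 = tau.

Definition extremal_tracial_state := extreme_point tracial_state.

End Traces.

Section Linf.
Variables (R : realType) (A : cstarAlgType R).

Definition norm_bounded : {pred nat -> A} :=
  fun a => `[< exists M : R, forall n, rnorm (a n) <= M >].

Lemma norm_bounded_submod : submod_closed norm_bounded.
Proof.
split; first by apply/asboolP; exists 0 => n; rewrite rnorm0.
move=> k a b /asboolP[M aM] /asboolP[N bN]; apply/asboolP.
exists (rnorm k * M + N) => n; apply: le_trans (rnormD _ _) _.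
by rewrite lerD// rnormZ ler_wpM2l ?rnorm_ge0.
Qed.

HB.instance Definition _ :=
  GRing.isSubmodClosed.Build R[i] (nat -> A) norm_bounded norm_bounded_submod.

Record linf := Linf { linf_seq :> nat -> A; linf_bounded : linf_seq \in norm_bounded }.

HB.instance Definition _ := [isSub for linf_seq].
HB.instance Definition _ := [Choice of linf by <:].
HB.instance Definition _ := [SubChoice_isSubLmodule of linf by <:].

Implicit Types a b : linf.

Lemma linfP a : exists M : R, forall n, rnorm (a n) <= M.
Proof. by case: a => a /= /asboolP. Qed.

Lemma linf_mul_subproof a b : (fun n => a n ** b n) \in norm_bounded.
Proof.
have [M aM] := linfP a; have [N bN] := linfP b.
apply/asboolP; exists (M * N) => n; apply: le_trans (rnormM _ _) _.
by rewrite ler_pM ?rnorm_ge0.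
Qed.
Definition linf_mul a b : linf := Linf (linf_mul_subproof a b).

Lemma linf_star_subproof a : (fun n => star (a n)) \in norm_bounded.
Proof.
have [M aM] := linfP a.
by apply/asboolP; exists M => n; rewrite rnorm_star.
Qed.
Definition linf_star a : linf := Linf (linf_star_subproof a).

Lemma linf_eq a b : (forall n, a n = b n) -> a = b.
Proof. by move=> ab; apply: val_inj; apply: funext. Qed.

End Linf.

Section UltraLimit.
Variables (R : realType) (U : set_system nat).
Context {UU : UltraFilter U}.

Lemma ultra_is_cvg (f : nat -> R) (M : R) :
  (forall n, 0 <= f n <= M) -> cvg (f n @[n --> U]).
Proof.
move=> fM.
have FU : ProperFilter (f n @[n --> U]) by exact: fmap_proper_filter.
have [|p [_ clp]] := @segment_compact R 0 M _ FU.
  by apply: (@filterE _ U) => n; move: (fM n); rewrite /= in_itv.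
apply/cvg_ex; exists p => B pB.
have [//|nB] := in_ultra_setVsetC (f @^-1` B) UU.
have [x [xB Bx]] := clp (~` B) B nB pB.
by [].
Qed.

End UltraLimit.

Lemma complete_seq (R : realType) (V : completeNormedModType R[i])
    (u : nat -> V) (e : nat -> R) :
  (forall K L, (K <= L)%N -> rnorm (u L - u K) <= e K) ->
  e n @[n --> \oo] --> 0 ->
  exists l : V, forall K, rnorm (l - u K) <= e K.
Proof.
move=> ue e0.
have cu : cauchy (u n @[n --> \oo]).
  apply: cauchy_exP => eps eps0.
  have epsE : eps = (complex.Re eps)%:C by rewrite RRe_real ?gtr0_real.
  have Reps : 0 < complex.Re eps by rewrite -ltcR -epsE.
  have [K _ Ke] := @cvgr_lt _ _ _ _ _ _ e0 _ Reps.
  exists (u K); exists K => // L KL.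
  rewrite -ball_normE /ball_/= rnormE epsE ltcR rnormBC.
  by apply: le_lt_trans (ue _ _ KL) (Ke K (leqnn K)).
have /cvg_ex[l ul] : cvg (u n @[n --> \oo]) by exact: cauchy_cvg cu.
exists l => K; apply/ler_addgt0Pl => d d0.
have d0C : 0 < d%:C by rewrite ltcR.
have /cvgrPdist_le/(_ _ d0C)[N _ NL] := ul.
have := NL (maxn N K) (leq_maxl _ _); rewrite /= rnorm_le => le1.
rewrite -(subrK (u (maxn N K)) l) -addrA.
apply: le_trans (rnormD _ _) _; apply: lerD => //.
exact/ue/leq_maxr.
Qed.

Section Ultrapower.
Variables (R : realType) (A : cstarAlgType R) (U : set_system nat).
Variable (UU : UltraFilter U).

Implicit Types (a b : linf A) (k : R[i]).

Definition cU : {pred linf A} :=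
  fun a => `[< rnorm (a n) @[n --> U] --> (0 : R) >].

Lemma cU_squeeze (f : nat -> R) (a : linf A) :
  (forall n, rnorm (a n) <= f n) -> f n @[n --> U] --> 0 -> a \in cU.
Proof.
move=> af f0; apply/asboolP.
apply: (@squeeze_cvgr _ _ _ _ (fun=> 0) f) => //; last exact: cvg_cst.
by apply: filterE => n; rewrite rnorm_ge0 af.
Qed.

Lemma cU_zmod : zmod_closed cU.
Proof.
split; first by apply: (@cU_squeeze (fun=> 0)) => [n|]; [rewrite rnorm0|exact: cvg_cst].
move=> a b /asboolP a0 /asboolP b0.
apply: (@cU_squeeze (fun n => rnorm (a n) + rnorm (b n))) => [n|].
  by apply: le_trans (rnormD _ _) _; rewrite rnormN.
by rewrite -[0]addr0; exact: cvgD.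
Qed.

HB.instance Definition _ := GRing.isZmodClosed.Build (linf A) cU cU_zmod.

Lemma cU_scale k a : a \in cU -> k *: a \in cU.
Proof.
move=> /asboolP a0; apply: (@cU_squeeze (fun n => rnorm k * rnorm (a n))).
  by move=> n; rewrite rnormZ.
by rewrite -(mulr0 (rnorm k)); apply: cvgM => //; exact: cvg_cst.
Qed.

Lemma cU_mulr a b : a \in cU -> linf_mul a b \in cU.
Proof.
move=> /asboolP a0; have [M bM] := linfP b.
apply: (@cU_squeeze (fun n => rnorm (a n) * M)).
  by move=> n; apply: le_trans (rnormM _ _) _; rewrite ler_wpM2l ?rnorm_ge0.
by rewrite -(mul0r M); apply: cvgM => //; exact: cvg_cst.
Qed.

Lemma cU_mull a b : b \in cU -> linf_mul a b \in cU.
Proof.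
move=> /asboolP b0; have [M aM] := linfP a.
apply: (@cU_squeeze (fun n => M * rnorm (b n))).
  by move=> n; apply: le_trans (rnormM _ _) _; rewrite ler_wpM2r ?rnorm_ge0.
by rewrite -(mulr0 M); apply: cvgM => //; exact: cvg_cst.
Qed.

Lemma cU_star a : a \in cU -> linf_star a \in cU.
Proof.
move=> /asboolP a0; apply: (@cU_squeeze (fun n => rnorm (a n))) => // n.
by rewrite rnorm_star.
Qed.

(* UU enters only through the proof that cU is a subgroup. *)
Definition ultrapower : Type := Quotient.quot (cU : zmodClosed (linf A)).
HB.instance Definition _ := GRing.Zmodule.on ultrapower.

Definition uclass (a : linf A) : ultrapower := \pi%qT a.


Lemma uclass_eq a b : a - b \in cU -> uclass a = uclass b.
Proof. by move=> ab; apply/eqP; rewrite -Quotient.idealrBE. Qed.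

Lemma uclass_eqP a b : uclass a = uclass b -> a - b \in cU.
Proof. by move=> ab; rewrite Quotient.idealrBE; apply/eqP. Qed.

Implicit Types x y : ultrapower.

Definition urepr (x : ultrapower) : linf A := generic_quotient.repr x.

Lemma ureprK x : uclass (urepr x) = x.
Proof. exact: reprK. Qed.

Lemma urepr_uclass a : urepr (uclass a) - a \in cU.
Proof. by apply: uclass_eqP; rewrite ureprK. Qed.

Lemma uclassW (P : ultrapower -> Prop) : (forall a, P (uclass a)) -> forall x, P x.
Proof. by move=> h x; rewrite -[x]ureprK. Qed.

Lemma uclassD a b : uclass (a + b) = uclass a + uclass b.
Proof. exact: Quotient.pi_add. Qed.

Lemma uclassN a : uclass (- a) = - uclass a.
Proof. exact: Quotient.pi_opp. Qed.

Lemma uclass0 : uclass 0 = 0.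
Proof. by rewrite -[0 in LHS](subrr 0) uclassD uclassN subrr. Qed.

Lemma uclassB a b : uclass (a - b) = uclass a - uclass b.
Proof. by rewrite uclassD uclassN. Qed.

Definition uscale (k : R[i]) (x : ultrapower) : ultrapower := uclass (k *: urepr x).
Definition umul (x y : ultrapower) : ultrapower :=
  uclass (linf_mul (urepr x) (urepr y)).
Definition ustar (x : ultrapower) : ultrapower := uclass (linf_star (urepr x)).

Lemma uscaleE k a : uscale k (uclass a) = uclass (k *: a).
Proof. by apply: uclass_eq; rewrite -scalerBr cU_scale// urepr_uclass. Qed.

Lemma umulE a b : umul (uclass a) (uclass b) = uclass (linf_mul a b).
Proof.
apply: uclass_eq; set a' := urepr _; set b' := urepr _.
have -> : linf_mul a' b' - linf_mul a b =
    linf_mul (a' - a) b' + linf_mul a (b' - b).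
  apply: linf_eq => n; rewrite /= /GRing.add/= cmulDl cmulDr cmulNr cmulrN.
  by rewrite addrA subrK.
by apply: rpredD; [apply: cU_mulr|apply: cU_mull]; exact: urepr_uclass.
Qed.

Lemma ustarE a : ustar (uclass a) = uclass (linf_star a).
Proof.
apply: uclass_eq; have -> : linf_star (urepr (uclass a)) - linf_star a =
    linf_star (urepr (uclass a) - a).
  by apply: linf_eq => n; rewrite /= starD starN.
by rewrite cU_star ?urepr_uclass.
Qed.

Let uscaleA k l x : uscale k (uscale l x) = uscale (k * l) x.
Proof. by elim/uclassW: x => a; rewrite !uscaleE scalerA. Qed.

Let uscale1 : left_id 1 uscale.
Proof. by elim/uclassW=> a; rewrite uscaleE scale1r. Qed.

Let uscaleDr : right_distributive uscale +%R.
Proof.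
move=> k; elim/uclassW => a; elim/uclassW => b.
by rewrite -uclassD !uscaleE -uclassD scalerDr.
Qed.

Let uscaleDl x : {morph uscale^~ x : k l / k + l}.
Proof. by move=> k l; elim/uclassW: x => a; rewrite !uscaleE -uclassD scalerDl. Qed.

HB.instance Definition _ :=
  GRing.Zmodule_isLmodule.Build R[i] ultrapower uscaleA uscale1 uscaleDr uscaleDl.

Lemma uclassZ k a : uclass (k *: a) = k *: uclass a.
Proof. by rewrite -uscaleE. Qed.

(* This is the quotient norm of linf A by cU: see ultrapower_quotient_norm. *)
Definition unorm (x : ultrapower) : R := lim (rnorm (urepr x n) @[n --> U]).

Lemma linf_is_cvg (a : linf A) : cvg (rnorm (a n) @[n --> U]).
Proof.
have [M aM] := linfP a; apply: (@ultra_is_cvg _ _ _ _ M) => n.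
by rewrite rnorm_ge0 aM.
Qed.

Lemma unorm_cvg a : rnorm (a n) @[n --> U] --> unorm (uclass a).
Proof.
set b := urepr (uclass a).
have /asboolP ba : b - a \in cU := urepr_uclass a.
have bu : rnorm (b n) @[n --> U] --> unorm (uclass a) := @linf_is_cvg b.
apply: (@squeeze_cvgr _ _ _ _ (fun n => rnorm (b n) - rnorm ((b - a) n))
  (fun n => rnorm (b n) + rnorm ((b - a) n))).
- apply: filterE => n; apply/andP; split.
    by rewrite lerBlDr -[X in rnorm X](subrKC (a n)) rnormD.
  rewrite -[X in rnorm X <= _](subKr (b n)).
  by apply: le_trans (rnormD _ _) _; rewrite rnormN.
- by rewrite -[unorm _]subr0; apply: cvgB.
- by rewrite -[unorm _]addr0; apply: cvgD.
Qed.

Lemma unorm_unique a (l : R) : rnorm (a n) @[n --> U] --> l -> unorm (uclass a) = l.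
Proof.
move=> al; rewrite -(cvg_lim (@norm_hausdorff _ _) al).
by rewrite (cvg_lim (@norm_hausdorff _ _) (@unorm_cvg a)).
Qed.

Lemma unormE a : unorm (uclass a) = lim (rnorm (a n) @[n --> U]).
Proof. by apply: unorm_unique; exact: linf_is_cvg. Qed.

Lemma unorm_le a (l : R) : (\forall n \near U, rnorm (a n) <= l) -> unorm (uclass a) <= l.
Proof. by rewrite unormE => h; apply: limr_le => //; exact: linf_is_cvg. Qed.

Lemma unorm_ge a (l : R) : (\forall n \near U, l <= rnorm (a n)) -> l <= unorm (uclass a).
Proof. by rewrite unormE => h; apply: limr_ge => //; exact: linf_is_cvg. Qed.

Lemma unorm_ge0 x : 0 <= unorm x.
Proof. by elim/uclassW: x => a; apply: unorm_ge; apply: filterE => n; exact: rnorm_ge0. Qed.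

Lemma ucvg_le (f g : nat -> R) (l l' : R) : f n @[n --> U] --> l ->
  g n @[n --> U] --> l' -> (forall n, f n <= g n) -> l <= l'.
Proof.
move=> fl gl fg; rewrite -(cvg_lim (@norm_hausdorff _ _) gl) -subr_ge0.
rewrite -(cvg_lim (@norm_hausdorff _ _) fl) -limB; last 2 first.
  by apply/cvg_ex; exists l'.
  by apply/cvg_ex; exists l.
apply: limr_ge; first by apply/cvg_ex; exists (l' - l); exact: cvgB.
by apply: filterE => n; rewrite subr_ge0.
Qed.

Let unormD x y : (unorm (x + y))%:C <= (unorm x)%:C + (unorm y)%:C.
Proof.
elim/uclassW: x => a; elim/uclassW: y => b.
rewrite -uclassD -rmorphD lecR.
apply: (ucvg_le (@unorm_cvg _) (cvgD (@unorm_cvg a) (@unorm_cvg b))) => n.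
exact: rnormD.
Qed.

Let unormZ (k : R[i]) x : (unorm (k *: x))%:C = `|k| * (unorm x)%:C.
Proof.
elim/uclassW: x => a; rewrite -uclassZ rnormE -rmorphM; congr _%:C.
apply: unorm_unique; apply: (@cvg_trans _ (rnorm k * rnorm (a n) @[n --> U])).
  by apply: near_eq_cvg; apply: filterE => n; rewrite /= rnormZ.
by apply: cvgM; [exact: cvg_cst|exact: unorm_cvg].
Qed.

Let unorm0_eq0 x : (unorm x)%:C = 0 -> x = 0.
Proof.
elim/uclassW: x => a /complexI a0; rewrite -uclass0; apply: uclass_eq.
by rewrite subr0; apply/asboolP; rewrite -a0; exact: unorm_cvg.
Qed.

HB.instance Definition _ := Lmodule_isNormed.Build R[i] ultrapower
  unormD unormZ unorm0_eq0.

Lemma ultrapower_norm x : `|x| = (unorm x)%:C.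
Proof. by []. Qed.

Lemma rnorm_unorm x : rnorm x = unorm x.
Proof. by []. Qed.

Lemma uclass_lift a (e : R) : unorm (uclass a) < e ->
  exists2 b, uclass b = uclass a & forall n, rnorm (b n) <= e.
Proof.
move=> ae; have e0 : 0 <= e := le_trans (unorm_ge0 _) (ltW ae).
pose f n := if rnorm (a n) <= e then a n else 0.
have fe n : rnorm (f n) <= e by rewrite /f; case: ifP => //; rewrite rnorm0.
have fB : f \in @norm_bounded R A by apply/asboolP; exists e.
exists (Linf fB) => //; apply: uclass_eq; apply/asboolP.
apply: cvg_near_cst.
have : \forall n \near U, rnorm (a n) < e.
  by apply: (@cvgr_lt _ _ _ _ _ _ (@unorm_cvg a)).
by apply: filterS => n /ltW ane; rewrite [X in rnorm X](_ : _ = f n - a n)// /f ane subrr rnorm0.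
Qed.

Lemma ultrapower_quotient_norm x :
  unorm x = inf [set sup [set rnorm (a n) | n in setT] | a in [set a | uclass a = x]].
Proof.
have supP (a : linf A) : has_sup [set rnorm (a n) | n in setT].
  split; first by exists (rnorm (a 0%N)); exists 0%N.
  by have [M aM] := linfP a; exists M => _ [n _ <-].
set S := [set _ | _ in _].
have lbS : lbound S (unorm x).
  move=> _ [a /= <- <-]; apply: unorm_le; apply: filterE => n.
  by apply: ub_le_sup; [case: (supP a)|exists n].
apply/eqP; rewrite eq_le; apply/andP; split.
  apply: lb_le_inf => //; exists (sup [set rnorm (urepr x n) | n in setT]).
  by exists (urepr x) => //=; rewrite ureprK.
apply/ler_addgt0Pl => e e0.
have [|b bx be] := @uclass_lift (urepr x) (e + unorm x).
  by rewrite ureprK ltrDr.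
apply: (@le_trans _ _ (sup [set rnorm (b n) | n in setT])).
  apply: ge_inf; first by exists (unorm x).
  by exists b => //=; rewrite bx ureprK.
apply: ge_sup; first by case: (supP b).
by move=> _ [n _ <-].
Qed.

Lemma ultrapower_complete (F : set_system ultrapower) :
  ProperFilter F -> cauchy F -> cvg F.
Proof.
move=> FF /cauchyP Fc; pose g j : R := 2^-1 ^+ j.
have g0 j : 0 < g j by rewrite exprn_gt0.
have half2 : 2^-1 + 2^-1 = 1 :> R by rewrite -div1r -splitr.
have gS j : g j = g j.+1 + g j.+1 by rewrite /g exprS -mulrDl half2 mul1r.
have g_cvg : g n @[n --> \oo] --> 0.
  by apply: cvg_expr; rewrite ger0_norm// invf_lt1// ltr1n.
have /choice[x xF] : forall j, exists x, F (ball x (g j)%:C).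
  by move=> j; apply: Fc; rewrite ltcR.
have xx j : unorm (x j.+1 - x j) < g j + g j.
  have [y []] := filter_ex (filterI (xF j.+1) (xF j)).
  rewrite -!ball_normE /ball_/= !rnormE !ltcR => y1 y2.
  rewrite -rnorm_unorm -(subrK y (x j.+1)) -addrA.
  apply: le_lt_trans (rnormD _ _) _; apply: ltrD; last by rewrite rnormBC.
  by apply: lt_trans y1 _; rewrite [g j]gS ltrDl.
have /choice[b bP] : forall j, exists b, uclass b = x j.+1 - x j /\
    forall n, rnorm (b n) <= g j + g j.
  move=> j; have [|b bx be] := @uclass_lift (urepr (x j.+1 - x j)) (g j + g j).
    by rewrite ureprK.
  by exists b; rewrite bx ureprK.
pose w := fix w j := if j is j'.+1 then w j' + b j' else urepr (x 0%N).
have wx j : uclass (w j) = x j.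
  elim: j => [|j IH] /=; first exact: ureprK.
  by rewrite uclassD IH (bP j).1 subrKC.
pose e j := g j *+ 4.
have eS j : e j = g j + g j + e j.+1.
  have -> : e j.+1 = g j *+ 2 by rewrite [g j]gS -mulr2n -mulrnA.
  by rewrite -[g j + g j]mulr2n /e -(mulrnDr _ 2 2).
have ww n K L : (K <= L)%N -> rnorm (w L n - w K n) <= e K - e L.
  elim: L => [|L IH]; first by rewrite leqn0 => /eqP ->; rewrite !subrr rnorm0.
  rewrite leq_eqVlt => /predU1P[->|]; first by rewrite !subrr rnorm0.
  rewrite ltnS => /IH {}IH; rewrite /= addrAC.
  apply: le_trans (rnormD _ _) _.
  apply: le_trans (lerD IH ((bP L).2 n)) _.
  by rewrite lerBrDr -addrA -eS subrK.
have e_ge0 j : 0 <= e j by rewrite mulrn_wge0// ltW.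
have e_cvg : e n @[n --> \oo] --> 0.
  by rewrite -[0](mul0rn _ 4); apply: cvgMn.
have /choice[z zP] : forall n, exists l : A, forall K, rnorm (l - w K n) <= e K.
  move=> n; apply: (@complete_seq _ _ (fun K => w K n)) => // K L KL.
  by apply: le_trans (ww n K L KL) _; rewrite gerBl.
have zB : z \in @norm_bounded R A.
  have [M wM] := linfP (w 0%N); apply/asboolP; exists (e 0%N + M) => n.
  rewrite -[z n](subrK (w 0%N n)); apply: le_trans (rnormD _ _) _.
  exact: lerD.
apply/cvg_ex; exists (uclass (Linf zB)).
apply/cvgrPdist_le => eps eps0.
have epsE : eps = (complex.Re eps)%:C by rewrite RRe_real ?gtr0_real.
have Reps : 0 < complex.Re eps by rewrite -ltcR -epsE.
have eg_cvg : e n + g n @[n --> \oo] --> 0 by rewrite -[0]addr0; exact: cvgD.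
have [K _ /(_ _ (leqnn K)) Ke] := @cvgr_lt _ _ _ _ _ _ eg_cvg _ Reps.
apply: filterS (xF K) => y; rewrite -!ball_normE /ball_/= !rnormE epsE ltcR lecR => xy.
rewrite -(subrK (x K) (uclass _)) -addrA; apply: le_trans (rnormD _ _) _.
apply: le_trans _ (ltW Ke); apply: lerD; last exact: ltW.
rewrite -wx -uclassB rnorm_unorm; apply: unorm_le; apply: filterE => n.
exact: zP.
Qed.

HB.instance Definition _ := Uniform_isComplete.Build ultrapower ultrapower_complete.

Let umulA : associative umul.
Proof.
elim/uclassW => a; elim/uclassW => b; elim/uclassW => c.
by rewrite !umulE; congr uclass; apply: linf_eq => n /=; rewrite cmulA.
Qed.

Let umulDl : left_distributive umul +%R.
Proof.
elim/uclassW => a; elim/uclassW => b; elim/uclassW => c.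
rewrite -uclassD !umulE -uclassD; congr uclass.
by apply: linf_eq => n /=; rewrite cmulDl.
Qed.

Let umulDr : right_distributive umul +%R.
Proof.
elim/uclassW => a; elim/uclassW => b; elim/uclassW => c.
rewrite -uclassD !umulE -uclassD; congr uclass.
by apply: linf_eq => n /=; rewrite cmulDr.
Qed.

Let uscaleAl k x y : k *: umul x y = umul (k *: x) y.
Proof.
elim/uclassW: x => a; elim/uclassW: y => b.
rewrite -uclassZ !umulE -uclassZ; congr uclass.
by apply: linf_eq => n /=; rewrite -cscaleAl.
Qed.

Let uscaleAr k x y : k *: umul x y = umul x (k *: y).
Proof.
elim/uclassW: x => a; elim/uclassW: y => b.
rewrite -uclassZ !umulE -uclassZ; congr uclass.
by apply: linf_eq => n /=; rewrite -cscaleAr.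
Qed.

Let ustarK : involutive ustar.
Proof.
elim/uclassW => a; rewrite !ustarE; congr uclass.
by apply: linf_eq => n /=; rewrite starK.
Qed.

Let ustarD : {morph ustar : x y / x + y}.
Proof.
elim/uclassW => a; elim/uclassW => b.
rewrite -uclassD !ustarE -uclassD; congr uclass.
by apply: linf_eq => n /=; rewrite starD.
Qed.

Let ustarZ k x : ustar (k *: x) = k^* *: ustar x.
Proof.
elim/uclassW: x => a; rewrite -uclassZ !ustarE -uclassZ; congr uclass.
by apply: linf_eq => n /=; rewrite starZ.
Qed.

Let ustarM x y : ustar (umul x y) = umul (ustar y) (ustar x).
Proof.
elim/uclassW: x => a; elim/uclassW: y => b.
rewrite !(umulE, ustarE); congr uclass.
by apply: linf_eq => n /=; rewrite starM.
Qed.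

Let unormM x y : `|umul x y| <= `|x| * `|y|.
Proof.
elim/uclassW: x => a; elim/uclassW: y => b.
rewrite umulE !ultrapower_norm -rmorphM lecR.
apply: (ucvg_le (@unorm_cvg _) (cvgM (@unorm_cvg a) (@unorm_cvg b))) => n.
exact: rnormM.
Qed.

Let unorm_star x : `|umul (ustar x) x| = `|x| ^+ 2.
Proof.
elim/uclassW: x => a; rewrite ustarE umulE !ultrapower_norm -rmorphXn.
congr _%:C; apply: unorm_unique; rewrite expr2.
apply: (@cvg_trans _ (rnorm (a n) * rnorm (a n) @[n --> U])).
  by apply: near_eq_cvg; apply: filterE => n; rewrite /= rnorm_star2 expr2.
exact: (cvgM (@unorm_cvg a) (@unorm_cvg a)).
Qed.

HB.instance Definition _ := CompleteNormedModule_isCStarAlgebra.Build R ultrapower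
  umulA umulDl umulDr uscaleAl uscaleAr ustarK ustarD ustarZ ustarM unormM unorm_star.

End Ultrapower.

Section ULimit.
Variables (R : realType) (A : cstarAlgType R) (U : set_system nat).
Variable (UU : UltraFilter U).

Definition norm_bounded_functionals (tau_ : nat -> A -> R[i]) :=
  exists M : R, forall n, functional_norm (tau_ n) <= M.

Definition is_ultralimit (tau_ : nat -> A -> R[i]) (tau : ultrapower A UU -> R[i]) :=
  forall a : linf A, tau_ n (a n) @[n --> U] --> tau (uclass UU a).

Definition ultralimit_of_traces (tau : ultrapower A UU -> R[i]) :=
  exists tau_ : nat -> A -> R[i],
    [/\ forall n, is_trace (tau_ n), norm_bounded_functionals tau_ &
      is_ultralimit tau_ tau].

End ULimit.

(* Main.v *)
Require Import Defs.
From HB Require Import structures.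
From mathcomp Require Import all_boot all_order all_algebra.
From mathcomp Require Import complex ring lra.
From mathcomp Require Import all_classical all_reals all_analysis.

(** Let tau_0, tau_1, ... be distinct extremal tracial states of A. The trace
    sigma : (a_n) |-> lim_{k -> U} lim_{n -> U} tau_k(a_n) on the ultrapower is
    not a U-limit of traces rho_n. Indeed, subtract from rho_n greedily the
    largest possible multiples c_{n,k} tau_k, for k = 0, 1, ... Testing sigma on
    contractions w_n which are large for tau_k and almost null for all tau_j with
    j < n and j <> k shows that c_{n,k} -> 0 for each k. Hence there are m_n -> oo
    such that c_{n,0} + ... + c_{n,m_n - 1} -> 0, and contractions w_n which are
    large for every tau_k with k < m_n and almost null for the rest of rho_n
    satisfy lim rho_n(w_n^* w_n) = 0 < sigma(w^* w).

    Such contractions exist because traces phi, psi without a common nonzero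
    minorant can be separated. Put tau = phi + psi and let x_n be selfadjoint
    elements minimising tau(x^2) - 2 Re phi(x); in the Hilbert space of tau they
    converge to the density h of phi with respect to tau. The functional
    lim psi(x_n y) = tau(h (1 - h) y) is a trace below phi and psi, hence it is
    zero, so that x_n is close to 1 for phi and to 0 for psi. The polynomial
    (1 - (1 + i r x)^N) / (1 - (1 + i r)^N) with r = tan(pi / N) and N large
    turns x_n into almost a contraction, because 1 + i r x is almost unitary
    when r is small and (1 + i r)^N <= -1. *)

Local Open Scope classical_set_scope.

Section TracesOnUltrapowers.
Import Order.TTheory GRing.Theory Num.Theory numFieldNormedType.Exports.
Set Implicit Arguments.
Unset Strict Implicit.
Local Open Scope ring_scope.
Local Open Scope complex_scope.

(** * Complex numbers: real parts, absolute values, a discriminant bound *)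

Section ComplexPrelim.
Variable R : realType.
Implicit Types (z w k : R[i]) (t : R).

Lemma cReD z w : complex.Re (z + w) = complex.Re z + complex.Re w.
Proof. by case: z w => [? ?] [? ?]. Qed.

Lemma cImD z w : complex.Im (z + w) = complex.Im z + complex.Im w.
Proof. by case: z w => [? ?] [? ?]. Qed.

Lemma cReN z : complex.Re (- z) = - complex.Re z.
Proof. by case: z. Qed.

Lemma cImN z : complex.Im (- z) = - complex.Im z.
Proof. by case: z. Qed.

Lemma cReM z w : complex.Re (z * w) =
  complex.Re z * complex.Re w - complex.Im z * complex.Im w.
Proof. by case: z w => [? ?] [? ?]. Qed.

Lemma cImM z w : complex.Im (z * w) =
  complex.Re z * complex.Im w + complex.Im z * complex.Re w.
Proof. by case: z w => [? ?] [? ?]. Qed.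

Lemma complex_eqP z w : complex.Re z = complex.Re w ->
  complex.Im z = complex.Im w -> z = w.
Proof. by case: z w => [? ?] [? ?] /= -> ->. Qed.

Lemma complex_ge0P z :
  0 <= z <-> 0 <= complex.Re z /\ complex.Im z = 0.
Proof. by rewrite lecE /=; split=> [/andP[/eqP]|[-> ->]]; rewrite ?eqxx. Qed.

Lemma rnorm_sqr z : rnorm z ^+ 2 = complex.Re z ^+ 2 + complex.Im z ^+ 2.
Proof. by apply: complexI; rewrite rmorphXn /= -rnormE add_Re2_Im2. Qed.

Lemma rnormCM z w : rnorm (z * w) = rnorm z * rnorm w.
Proof. by rewrite -rnormZ. Qed.

Lemma rnormCX z n : rnorm (z ^+ n) = rnorm z ^+ n.
Proof.
elim: n => [|n IH]; last by rewrite !exprS rnormCM IH.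
by rewrite !expr0 /rnorm normr1.
Qed.

Lemma rnorm_real t : rnorm (t%:C : R[i]) = `|t|.
Proof. by rewrite /rnorm normc_def /= expr0n addr0 sqrtr_sqr. Qed.

Lemma rnorm_imag t : rnorm (Complex 0 t : R[i]) = `|t|.
Proof. by rewrite /rnorm normc_def /= expr0n add0r sqrtr_sqr. Qed.

Lemma conj_imag t : Num.conj (Complex 0 t : R[i]) = - Complex 0 t.
Proof. by apply: complex_eqP; rewrite /= ?oppr0. Qed.

Lemma conj_real t : Num.conj (t%:C : R[i]) = t%:C.
Proof. by apply: complex_eqP; rewrite /= ?oppr0. Qed.

Lemma rnormJ z : rnorm (z^*) = rnorm z.
Proof. by rewrite /rnorm normcJ. Qed.

Lemma Re_le_rnorm z : `|complex.Re z| <= rnorm z.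
Proof.
rewrite -ler_sqr ?nnegrE ?rnorm_ge0// rnorm_sqr real_normK ?num_real//.
by rewrite lerDl sqr_ge0.
Qed.

Lemma Im_le_rnorm z : `|complex.Im z| <= rnorm z.
Proof.
rewrite -ler_sqr ?nnegrE ?rnorm_ge0// rnorm_sqr real_normK ?num_real//.
by rewrite lerDr sqr_ge0.
Qed.

Lemma rnorm_le_ReIm z : rnorm z <= `|complex.Re z| + `|complex.Im z|.
Proof.
rewrite -ler_sqr ?nnegrE ?rnorm_ge0 ?addr_ge0// rnorm_sqr sqrrD.
rewrite !real_normK ?num_real// -addrA lerD2l lerDr.
by rewrite mulrn_wge0 ?mulr_ge0.
Qed.

(** Lets a bound on real parts of a linear functional pass to its absolute value, by rotating the
    argument. *)
Lemma rotate_real z : exists2 u : R[i], rnorm u = 1 & complex.Re (u * z) = rnorm z.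
Proof.
have [->|z0] := eqVneq z 0; first by exists 1; rewrite ?mulr0 ?rnorm0// /rnorm normr1.
have nz : rnorm z != 0 by apply: contra_neq z0; exact: rnorm0_eq0.
exists ((rnorm z)^-1%:C * z^*).
  rewrite rnormCM rnormJ rnorm_real ger0_norm ?invr_ge0 ?rnorm_ge0//.
  by rewrite mulVf.
rewrite -mulrA mulrC.
have -> : z^* * z = (rnorm z ^+ 2)%:C.
  by rewrite rmorphXn /= -rnormE sqr_normc mulrC.
by rewrite -rmorphM/= expr2 mulfK.
Qed.

(** Evaluation at the vertex [- w / p]. Serves both for Cauchy-Schwarz and for the first-order
    condition at an almost minimiser. *)
Lemma quadratic_ge0 (s w p : R) : 0 <= s -> 0 <= p ->
  (forall t, 0 <= s + 2 * t * w + t ^+ 2 * p) -> w ^+ 2 <= s * p.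
Proof.
move=> s0 p0 h; have [p0'|p_gt0] := leP p 0; last first.
  have := h (- w / p); have -> : s + 2 * (- w / p) * w + (- w / p) ^+ 2 * p =
    (s * p - w ^+ 2) / p by field; rewrite gt_eqF.
  by rewrite pmulr_lge0 ?invr_gt0// subr_ge0.
have pE : p = 0 by apply/le_anti; rewrite p0' p0.
have [->|w0] := eqVneq w 0; first by rewrite expr0n mulr_ge0.
(* With [p = 0] the polynomial is affine in [t]; this [t] makes it -1. *)
have := h (- (s + 1) / (2 * w)).
have -> : s + 2 * (- (s + 1) / (2 * w)) * w + (- (s + 1) / (2 * w)) ^+ 2 * p = -1.
  by rewrite pE; field.
by rewrite oppr_ge0 ler10.
Qed.

End ComplexPrelim.

(** * The Hilbert seminorm of a trace *)

Section TraceSeminorm.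
Variables (R : realType) (A : cstarAlgType R).
Implicit Types (phi : A -> R[i]) (a b x y : A).

(** Real part of the inner product of the GNS construction, hence a real symmetric form; [hs] is its
    2-seminorm. *)
Definition ip phi a b : R := complex.Re (phi (star a ** b)).
Definition hs phi a : R := Num.sqrt (ip phi a a).

Variable phi : A -> R[i].
Hypothesis phiT : is_trace phi.

Lemma traceD a b : phi (a + b) = phi a + phi b.
Proof. by have := trace_linear phiT 1 a b; rewrite scale1r mul1r. Qed.

Lemma trace0 : phi 0 = 0.
Proof. by apply: (addrI (phi 0)); rewrite -traceD !addr0. Qed.

Lemma traceZ k a : phi (k *: a) = k * phi a.
Proof. by have := trace_linear phiT k a 0; rewrite trace0 !addr0. Qed.

Lemma traceN a : phi (- a) = - phi a.
Proof. by rewrite -scaleN1r traceZ mulN1r. Qed.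

Lemma traceB a b : phi (a - b) = phi a - phi b.
Proof. by rewrite traceD traceN. Qed.

Lemma trace_bound : exists2 M : R, 0 <= M & forall a, rnorm (phi a) <= M * rnorm a.
Proof.
have [M hM] := trace_bounded phiT; exists `|M| => // a.
by apply: le_trans (hM a) _; rewrite ler_wpM2r ?rnorm_ge0 ?ler_norm.
Qed.

Lemma trace_sqE a : phi (star a ** a) = (ip phi a a)%:C.
Proof.
have /complex_ge0P[_ im0] := trace_positive phiT a.
exact: complex_eqP.
Qed.

Lemma ip_ge0 a : 0 <= ip phi a a.
Proof. by have /complex_ge0P[] := trace_positive phiT a. Qed.

(** Polarisation: [phi] is real on squares, and expanding those of a + b and a + i b gives the
    imaginary and the real parts. The formula for [star a] alone is [trace_star], which takes an
    approximate unit. *)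
Lemma trace_starM a b : phi (star b ** a) = (phi (star a ** b))^*.
Proof.
have h c : complex.Im (phi (star c ** c)) = 0.
  by have /complex_ge0P[] := trace_positive phiT c.
have := h (a + b); rewrite starD !(cmulDl, cmulDr) !traceD !cImD !h.
have := h (a + 'i *: b); rewrite starD starZ !(cmulDl, cmulDr).
rewrite -!cscaleAl -!cscaleAr scalerA !traceD !traceZ !cImD !cImM /= !h.
case: (phi (star a ** b)) => p q; case: (phi (star b ** a)) => p' q' /= h1 h2.
by apply: complex_eqP => /=; lra.
Qed.

Lemma ipC a b : ip phi a b = ip phi b a.
Proof. by rewrite /ip trace_starM; case: (phi _). Qed.

Lemma ipDr a b c : ip phi a (b + c) = ip phi a b + ip phi a c.
Proof. by rewrite /ip cmulDr traceD cReD. Qed.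

Lemma ipDl a b c : ip phi (a + b) c = ip phi a c + ip phi b c.
Proof. by rewrite ipC ipDr !(ipC c). Qed.

Lemma ipZr (t : R) a b : ip phi a (t%:C *: b) = t * ip phi a b.
Proof. by rewrite /ip -cscaleAr traceZ cReM /= mul0r subr0. Qed.

Lemma ipZl (t : R) a b : ip phi (t%:C *: a) b = t * ip phi a b.
Proof. by rewrite ipC ipZr ipC. Qed.

Lemma ipNr a b : ip phi a (- b) = - ip phi a b.
Proof. by rewrite /ip cmulrN traceN cReN. Qed.

Lemma ipNl a b : ip phi (- a) b = - ip phi a b.
Proof. by rewrite ipC ipNr ipC. Qed.

Lemma ipZZ k a : ip phi (k *: a) (k *: a) = rnorm k ^+ 2 * ip phi a a.
Proof.
rewrite rnorm_sqr /ip starZ -cscaleAl -cscaleAr scalerA traceZ trace_sqE cReM /=.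
by case: k => p q /=; ring.
Qed.

Lemma ip_star a b : ip phi (star a) (star b) = ip phi b a.
Proof. by rewrite /ip starK (trace_comm phiT). Qed.

Lemma hs_ge0 a : 0 <= hs phi a. Proof. exact: sqrtr_ge0. Qed.

Lemma hs_sqr a : hs phi a ^+ 2 = ip phi a a.
Proof. by rewrite sqr_sqrtr// ip_ge0. Qed.

Lemma hs_star a : hs phi (star a) = hs phi a.
Proof. by rewrite /hs ip_star. Qed.

Lemma hsZ k a : hs phi (k *: a) = rnorm k * hs phi a.
Proof.
by rewrite /hs ipZZ sqrtrM ?sqr_ge0// sqrtr_sqr ger0_norm ?rnorm_ge0.
Qed.

Lemma hsN a : hs phi (- a) = hs phi a.
Proof. by rewrite /hs ipNl ipNr opprK. Qed.

Lemma hs0 : hs phi 0 = 0.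
Proof. by rewrite /hs /ip cmulr0 trace0 sqrtr0. Qed.

Lemma ip_le a b : `|ip phi a b| <= hs phi a * hs phi b.
Proof.
rewrite -ler_sqr ?nnegrE ?mulr_ge0 ?hs_ge0// real_normK ?num_real//.
rewrite exprMn !hs_sqr; apply: quadratic_ge0; rewrite ?ip_ge0// => t.
have -> : ip phi a a + 2 * t * ip phi a b + t ^+ 2 * ip phi b b =
  ip phi (a + t%:C *: b) (a + t%:C *: b); last exact: ip_ge0.
by rewrite ipDl !ipDr !ipZl !ipZr (ipC b a); ring.
Qed.

Lemma rnorm_star_mul_le a b : rnorm (phi (star a ** b)) <= hs phi a * hs phi b.
Proof.
have [u u1 uE] := rotate_real (phi (star a ** b)).
rewrite -uE -traceZ cscaleAr -[ X in _ <= _ * X]mul1r -u1 -hsZ.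
exact: le_trans (ler_norm _) (ip_le _ _).
Qed.

Lemma rnorm_mul_le a b : rnorm (phi (a ** b)) <= hs phi a * hs phi b.
Proof. by rewrite -{1}[a]starK -(hs_star a) rnorm_star_mul_le. Qed.

Lemma hsD a b : hs phi (a + b) <= hs phi a + hs phi b.
Proof.
rewrite -ler_sqr ?nnegrE ?addr_ge0 ?hs_ge0// sqrrD !hs_sqr.
rewrite ipDl !ipDr (ipC b a).
have := le_trans (ler_norm _) (ip_le a b); lra.
Qed.

Lemma hsB a b : hs phi (a - b) <= hs phi a + hs phi b.
Proof. by rewrite -(hsN b) hsD. Qed.

(* Iterating the Cauchy-Schwarz inequality replaces [x] by [x ^ (2 ^ k)], which
   is where boundedness of [phi] enters. *)
Lemma ip_mul_le x y : ip phi (x ** y) (x ** y) <= rnorm x ^+ 2 * ip phi y y.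
Proof.
have [M M0 hM] := trace_bound.
pose c := fix c k := if k is j.+1 then c j ** c j else star x ** x.
have csa k : star (c k) = c k.
  by elim: k => [|k IH] /=; rewrite starM ?starK ?IH.
pose X := rnorm x ^+ 2; have X0 : 0 <= X by rewrite sqr_ge0.
have cX k : rnorm (c k) <= X ^+ (2 ^ k).
  elim: k => [|k IH] /=; first by rewrite expr1 rnorm_star2.
  apply: le_trans (rnormM _ _) _.
  by rewrite expnS mul2n -addnn exprD ler_pM ?rnorm_ge0.
pose q k := ip phi y (c k ** y); pose p := ip phi y y.
have p0 : 0 <= p := ip_ge0 y.
have qE : ip phi (x ** y) (x ** y) = q 0%N.
  by rewrite /q /ip starM /= !cmulA.
have q2 k : q k ^+ 2 <= p * q k.+1.
  have -> : q k.+1 = ip phi (c k ** y) (c k ** y).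
    by rewrite /q /ip starM csa /= !cmulA.
  have := ip_le y (c k ** y); rewrite -ler_sqr ?nnegrE ?mulr_ge0 ?hs_ge0//.
  by rewrite real_normK ?num_real// exprMn !hs_sqr.
have qX k : q k <= M * rnorm y ^+ 2 * X ^+ (2 ^ k).
  apply: le_trans (ler_norm _) _; apply: le_trans (Re_le_rnorm _) _.
  apply: le_trans (hM _) _; rewrite -mulrA ler_wpM2l//.
  have -> : rnorm y ^+ 2 * X ^+ (2 ^ k) = rnorm y * (X ^+ (2 ^ k) * rnorm y) by ring.
  apply: le_trans (rnormM _ _) _; rewrite rnorm_star ler_wpM2l ?rnorm_ge0//.
  by apply: le_trans (rnormM _ _) _; rewrite ler_wpM2r ?rnorm_ge0.
(* Otherwise [r := q 0 / p] exceeds [X]. Cauchy-Schwarz makes [q k] grow at least like r^(2^k),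
   while [qX] allows only X^(2^k), so the powers of X / r < 1 would stay bounded away from 0. *)
rewrite qE leNgt; apply/negP => Xq.
have q0 : 0 < q 0%N by apply: le_lt_trans Xq; rewrite mulr_ge0.
have p_gt0 : 0 < p.
  have := q2 0%N; rewrite lt_neqAle p0 andbT => h; apply/eqP => pE.
  by move: h; rewrite -pE mul0r lt_geF// exprn_gt0.
pose r := q 0%N / p; have r0 : 0 < r by rewrite divr_gt0.
have qr k : p * r ^+ (2 ^ k) <= q k.
  elim: k => [|k IH]; first by rewrite expr1 /r mulrCA divff ?mulr1// gt_eqF.
  rewrite -(ler_pM2l p_gt0); apply: le_trans (q2 k).
  have -> : p * (p * r ^+ (2 ^ k.+1)) = (p * r ^+ (2 ^ k)) ^+ 2.
    by rewrite expnS mul2n -addnn exprD; ring.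
  by rewrite ler_sqr ?nnegrE//; [rewrite mulr_ge0 ?exprn_ge0// ltW|
    apply: le_trans IH; rewrite mulr_ge0 ?exprn_ge0// ltW].
have Xr : X < r by rewrite ltr_pdivlMr.
have bnd k : r ^+ (2 ^ k) <= M * rnorm y ^+ 2 / p * X ^+ (2 ^ k).
  rewrite -(ler_pM2l p_gt0); apply: le_trans (qr k) _.
  have -> : p * (M * rnorm y ^+ 2 / p * X ^+ (2 ^ k)) = M * rnorm y ^+ 2 * X ^+ (2 ^ k).
    by field; rewrite gt_eqF.
  exact: qX.
pose d := X / r; have d0 : 0 <= d by rewrite divr_ge0// ltW.
have d1 : d < 1 by rewrite ltr_pdivrMr// mul1r.
have bnd' k : 1 <= M * rnorm y ^+ 2 / p * d ^+ k.
  have /le_trans : 1 <= M * rnorm y ^+ 2 / p * d ^+ (2 ^ k).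
    by rewrite expr_div_n mulrA ler_pdivlMr ?exprn_gt0// mul1r.
  apply; apply: ler_wpM2l.
    by rewrite divr_ge0// mulr_ge0// sqr_ge0.
  by apply: ler_wiXn2l; rewrite ?(ltW d1)// ltnW// ltn_expl.
have cv : M * rnorm y ^+ 2 / p * d ^+ k @[k --> \oo] --> (0 : R).
  rewrite -[0](mulr0 (M * rnorm y ^+ 2 / p)); apply: cvgM; first exact: cvg_cst.
  by apply: cvg_expr; rewrite ger0_norm.
have [K _ /(_ K (leqnn K))] := @cvgr_lt _ _ _ _ _ _ cv _ (@ltr01 R).
by rewrite ltNge bnd'.
Qed.

Lemma hs_mull x y : hs phi (x ** y) <= rnorm x * hs phi y.
Proof.
rewrite -ler_sqr ?nnegrE ?mulr_ge0 ?hs_ge0 ?rnorm_ge0// exprMn !hs_sqr.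
exact: ip_mul_le.
Qed.

Lemma hs_mulr x y : hs phi (x ** y) <= hs phi x * rnorm y.
Proof. by rewrite -hs_star starM mulrC -(rnorm_star y) -(hs_star x) hs_mull. Qed.

End TraceSeminorm.

(** * The almost unitary elements 1 + i r x, and traces in the absence of a unit *)

Section AlmostUnitary.
Variables (R : realType) (A : cstarAlgType R).
Implicit Types (a b x y : A) (r t : R).

Lemma cmulBl a b y : (a - b) ** y = a ** y - b ** y.
Proof. by rewrite cmulDl cmulNr. Qed.

Lemma cmulBr a b y : y ** (a - b) = y ** a - y ** b.
Proof. by rewrite cmulDr cmulrN. Qed.

Lemma starB a b : star (a - b) = star a - star b.
Proof. by rewrite starD starN. Qed.

(** Left multiplication by 1 + i r x, written without the unit that [A] may lack. *)
Definition vop x r y : A := y + (Complex 0 r) *: (x ** y).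

(* The element (1 + i r x)^k - 1 of the possibly nonunital algebra [A]. *)
Fixpoint vpow x r k : A :=
  if k is j.+1 then vop x r (vpow x r j) + (Complex 0 r) *: x else 0.

(** For selfadjoint [x] this bounds the squared norm of 1 + i r x, hence also the norm. Its excess
    over 1 is quadratic in [r], so the [k]-th power stays controlled as long as k r^2 does. *)
Definition vgrowth x r : R := 1 + (r * rnorm x) ^+ 2.

Lemma vgrowth_ge1 x r : 1 <= vgrowth x r.
Proof. by rewrite lerDl sqr_ge0. Qed.

Lemma vopD x r a b : vop x r (a + b) = vop x r a + vop x r b.
Proof. by rewrite /vop cmulDr scalerDr addrACA. Qed.

Lemma vopN x r a : vop x r (- a) = - vop x r a.
Proof. by rewrite /vop cmulrN scalerN opprD. Qed.

Lemma vopZ x r k a : vop x r (k *: a) = k *: vop x r a.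
Proof. by rewrite /vop scalerDr -cscaleAr !scalerA mulrC. Qed.

Lemma vpowM x r k y : vpow x r k ** y = iter k (vop x r) y - y.
Proof.
elim: k => [|k IH] /=; first by rewrite cmul0r subrr.
rewrite cmulDl -cscaleAl [vop _ _ _ ** y](_ : _ = vop x r (vpow x r k ** y)).
  by rewrite IH vopD vopN [in - vop _ _ y]/vop opprD !addrA subrK.
by rewrite /vop cmulDl -cscaleAl cmulA.
Qed.

(** Since [x] is selfadjoint, the terms linear in [r] cancel. *)
Lemma vop_sq x r y : star x = x ->
  star (vop x r y) ** vop x r y =
  star y ** y + (r ^+ 2)%:C *: (star (x ** y) ** (x ** y)).
Proof.
move=> xs; rewrite /vop starD starZ cmulDl !cmulDr -!cscaleAl -!cscaleAr scalerA.
have -> : star (x ** y) ** y = star y ** (x ** y) by rewrite starM xs cmulA.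
rewrite conj_imag scaleNr !addrA -[_ + _ - _]addrA subrr addr0; congr (_ + _ *: _).
by apply: complex_eqP => /=; ring.
Qed.

Lemma rnorm_vop x r y : star x = x -> rnorm (vop x r y) <= vgrowth x r * rnorm y.
Proof.
move=> xs; have g1 := vgrowth_ge1 x r; have g0 : 0 <= vgrowth x r by lra.
rewrite -ler_sqr ?nnegrE ?mulr_ge0 ?rnorm_ge0// -rnorm_star2 vop_sq//.
apply: le_trans (rnormD _ _) _; rewrite rnormZ !rnorm_star2 rnorm_real.
rewrite ger0_norm ?sqr_ge0//.
apply: (@le_trans _ _ (vgrowth x r * rnorm y ^+ 2)).
  have -> : vgrowth x r * rnorm y ^+ 2 =
    rnorm y ^+ 2 + r ^+ 2 * (rnorm x * rnorm y) ^+ 2 by rewrite /vgrowth; ring.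
  rewrite lerD2l; apply: ler_wpM2l; first exact: sqr_ge0.
  by rewrite ler_sqr ?nnegrE ?mulr_ge0 ?rnorm_ge0// rnormM.
by rewrite exprMn ler_wpM2r ?sqr_ge0// expr2 ler_peMr.
Qed.

Lemma rnorm_iter_vop x r k y : star x = x ->
  rnorm (iter k (vop x r) y) <= vgrowth x r ^+ k * rnorm y.
Proof.
move=> xs; have g0 : 0 <= vgrowth x r := le_trans ler01 (vgrowth_ge1 x r).
elim: k => [|k IH] /=; first by rewrite mul1r.
by apply: le_trans (rnorm_vop _ _ xs) _; rewrite exprS -mulrA ler_wpM2l.
Qed.

(** Take [y = star a] and use the C*-identity. Thus norms can be estimated through left
    multiplication, where [vop] makes sense. *)
Lemma rnorm_le_mul a (K : R) : 0 <= K ->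
  (forall y, rnorm (a ** y) <= K * rnorm y) -> rnorm a <= K.
Proof.
move=> K0 h; have [|a0] := leP (rnorm a) 0; first by move/le_trans; apply.
rewrite -(ler_pM2r a0) -[X in _ * X <= _]rnorm_star -[X in X * _ <= _]rnorm_star.
by rewrite -expr2 -rnorm_star2 starK -[X in _ * X]rnorm_star.
Qed.

Lemma rnorm_vpow x r k : star x = x -> rnorm (vpow x r k) <= 1 + vgrowth x r ^+ k.
Proof.
move=> xs; have g0 : 0 <= vgrowth x r := le_trans ler01 (vgrowth_ge1 x r).
apply: rnorm_le_mul => [|y]; first by rewrite addr_ge0 ?exprn_ge0.
rewrite vpowM; apply: le_trans (rnormD _ _) _; rewrite rnormN mulrDl mul1r addrC.
by rewrite lerD2l rnorm_iter_vop.
Qed.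

Lemma vgrowth_expR x r k : vgrowth x r ^+ k <= expR (k%:R * (r * rnorm x) ^+ 2).
Proof.
rewrite mulrC expRM_natr lerXn2r ?nnegrE ?expR_ge0 ?expR_ge1Dx//.
exact: le_trans ler01 (vgrowth_ge1 x r).
Qed.

Lemma vpow_sum x r n :
  (Complex 0 r) *: (n%:R *: x + x ** (\sum_(k < n) vpow x r k)) = vpow x r n.
Proof.
elim: n => [|n IH] /=; first by rewrite big_ord0 cmulr0 scale0r addr0 scaler0.
rewrite big_ord_recr /= /vop cmulDr -natr1 scalerDl scale1r addrACA scalerDr IH.
by rewrite scalerDr [X in _ + X]addrC addrA.
Qed.

(* With [n = m^2] and [r = 1 / (m |x|)], the mean of the first [n] powers of the
   almost unitary 1 + i r x is almost annihilated by [x]. *)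
Lemma approx_unit x (e : R) : star x = x -> 0 < e ->
  exists2 E : A, rnorm E <= 1 + expR 1 & rnorm (x - x ** E) <= e.
Proof.
move=> xs e0; have e1 : 0 < 1 + expR 1 :> R by rewrite addr_gt0 ?expR_gt0.
have [X0|X0] := leP (rnorm x) 0.
  exists 0; first by rewrite rnorm0 ltW.
  by rewrite cmulr0 subr0; apply: le_trans X0 (ltW e0).
pose X := rnorm x.
have [m hm] : exists m : nat, (1 + expR 1) * X / e <= m.+1%:R.
  exists (Num.truncn ((1 + expR 1) * X / e)).
  by rewrite ltW// truncnS_gt// divr_ge0 ?mulr_ge0 ?ltW.
pose M : R := m.+1%:R; have M0 : 0 < M by rewrite ltr0n.
pose n := (m.+1 ^ 2)%N; have nE : n%:R = M ^+ 2 :> R by rewrite natrX.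
have n0 : 0 < n%:R :> R by rewrite nE exprn_gt0.
pose r := (M * X)^-1; have r0 : 0 < r by rewrite invr_gt0 mulr_gt0.
(* Here k (r |x|)^2 = k / n <= 1, so the first n powers are bounded by e. *)
have gk k : (k <= n)%N -> vgrowth x r ^+ k <= expR 1.
  move=> kn; apply: le_trans (vgrowth_expR _ _ _) _; rewrite ler_expR.
  have -> : r * rnorm x = M^-1 by rewrite /r -/X; field; rewrite !gt_eqF.
  by rewrite exprVn -nE ler_pdivrMr// mul1r ler_nat.
pose S := \sum_(k < n) vpow x r k.
exists ((- n%:R^-1)%:C *: S).
  rewrite rnormZ rnorm_real normrN ger0_norm; last by rewrite invr_ge0 ltW.
  rewrite mulrC ler_pdivrMr// mulr_natr.
  suff h j : (j <= n)%N -> rnorm (\sum_(k < j) vpow x r k) <= (1 + expR 1) *+ j by exact: h.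
  elim: j => [|j IH] jn; first by rewrite big_ord0 rnorm0.
  rewrite big_ord_recr/= mulrSr; apply: le_trans (rnormD _ _) _.
  apply: lerD; first exact/IH/ltnW.
  by apply: le_trans (rnorm_vpow _ _ xs) _; rewrite lerD2l gk// ltnW.
(* By the geometric sum [vpow_sum] the error is [vpow x r n] divided by i r n, where r n = M / X is
   large. *)
have -> : x - x ** ((- n%:R^-1)%:C *: S) = (Complex 0 (r * n%:R))^-1 *: vpow x r n.
  have k0 : (Complex 0 (r * n%:R)) != 0 :> R[i].
    by apply/eqP => -[] /eqP; rewrite mulf_eq0 !gt_eqF.
  apply: (scalerI k0); rewrite scalerA divff// scale1r -vpow_sum -/S.
  rewrite -cscaleAr rmorphN scaleNr opprK.
  have -> : Complex 0 (r * n%:R) = Complex 0 r * n%:R :> R[i].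
    by rewrite -(rmorph_nat (real_complex R)); apply: complex_eqP => /=; ring.
  rewrite -scalerA; congr (_ *: _).
  rewrite scalerDr scalerA -(rmorph_nat (real_complex R)) -rmorphM/=.
  by rewrite divff ?gt_eqF// scale1r.
rewrite rnormZ.
have -> : rnorm (Complex 0 (r * n%:R))^-1 = (r * n%:R)^-1.
  apply: complexI; rewrite -rnormE normfV rnormE rnorm_imag.
  by rewrite ger0_norm ?mulr_ge0 ?ltW// fmorphV.
apply: (@le_trans _ _ ((r * n%:R)^-1 * (1 + expR 1))).
  apply: ler_wpM2l; first by rewrite invr_ge0 ltW// mulr_gt0.
  by apply: le_trans (rnorm_vpow _ _ xs) _; rewrite lerD2l gk.
have -> : (r * n%:R)^-1 * (1 + expR 1) = (1 + expR 1) * X / M.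
  by rewrite nE /r; field; rewrite !gt_eqF.
by rewrite ler_pdivrMr// [leRHS]mulrC -ler_pdivrMr.
Qed.

Variable phi : A -> R[i].
Hypothesis phiT : is_trace phi.

Lemma hs_vop x r y : star x = x -> hs phi (vop x r y) <= vgrowth x r * hs phi y.
Proof.
move=> xs; have g1 := vgrowth_ge1 x r; have g0 : 0 <= vgrowth x r by lra.
rewrite -ler_sqr ?nnegrE ?mulr_ge0 ?hs_ge0// (hs_sqr phiT) /ip vop_sq//.
rewrite (traceD phiT) (traceZ phiT) cReD !(trace_sqE phiT) -rmorphM/= exprMn (hs_sqr phiT).
have y0 := ip_ge0 phiT y.
apply: (@le_trans _ _ (vgrowth x r * ip phi y y)).
  have -> : vgrowth x r * ip phi y y =
    ip phi y y + r ^+ 2 * (rnorm x ^+ 2 * ip phi y y) by rewrite /vgrowth; ring.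
  rewrite lerD2l; apply: ler_wpM2l; first exact: sqr_ge0.
  exact: ip_mul_le.
by rewrite ler_wpM2r// expr2 ler_peMr.
Qed.

(** Telescoping: an almost eigenvector for [mu] is one for all powers. Each of the [k] replacements
    of the operator by [mu] costs one defect, amplified by at most [g ^+ k]. *)
Lemma hs_iter_vop x r (mu : R[i]) (g : R) k y : star x = x ->
  vgrowth x r <= g -> rnorm mu <= g ->
  hs phi (iter k (vop x r) y - mu ^+ k *: y) <=
  k%:R * g ^+ k * hs phi (vop x r y - mu *: y).
Proof.
move=> xs xg mug; have g1 : 1 <= g := le_trans (vgrowth_ge1 x r) xg.
have g0 : 0 <= g by lra.
set d := hs phi (_ - mu *: y); have d0 : 0 <= d by exact: hs_ge0.
elim: k => [|k IH]; first by rewrite /= scale1r subrr (hs0 phiT) !mul0r.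
have -> : iter k.+1 (vop x r) y - mu ^+ k.+1 *: y =
    vop x r (iter k (vop x r) y - mu ^+ k *: y) + mu ^+ k *: (vop x r y - mu *: y).
  by rewrite vopD vopN vopZ scalerBr scalerA -exprSr addrA subrK.
apply: le_trans (hsD phiT _ _) _.
rewrite -natr1 !mulrDl mul1r; apply: lerD.
  apply: le_trans (hs_vop _ _ xs) _; rewrite exprS.
  have -> : k%:R * (g * g ^+ k) * d = g * (k%:R * g ^+ k * d) by ring.
  by apply: ler_pM => //; [exact: le_trans ler01 (vgrowth_ge1 x r)|exact: hs_ge0].
rewrite (hsZ phiT) rnormCX ler_wpM2r//.
apply: (@le_trans _ _ (g ^+ k)); first by rewrite lerXn2r ?nnegrE ?rnorm_ge0.
by rewrite exprS ler_peMl ?exprn_ge0.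
Qed.

(** For selfadjoint [x] and an approximate unit [E], [phi (x ** E)] and [phi (star E ** x)] are
    conjugate by [trace_starM] and both close to [phi x], which is therefore real. The general case
    follows from a + a^* and i (a - a^* ). *)
Lemma trace_star a : phi (star a) = (phi a)^*.
Proof.
have [M M0 hM] := trace_bound phiT.
have sa x : star x = x -> complex.Im (phi x) = 0.
  move=> xs; apply/eqP; rewrite -normr_eq0 eq_le normr_ge0 andbT.
  apply/ler_addgt0Pr => e e0; rewrite add0r.
  have M1 : 0 < M + 1 by rewrite ltr_wpDl.
  have [E _ xE] := approx_unit xs (divr_gt0 e0 M1).
  have := trace_starM phiT x E; rewrite xs => h1.
  have hs1 : rnorm (phi (x - x ** E)) <= e.
    apply: le_trans (hM _) _; apply: (@le_trans _ _ ((M + 1) * rnorm (x - x ** E))).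
      by rewrite ler_wpM2r ?rnorm_ge0// lerDl.
    by rewrite mulrC -ler_pdivlMr.
  have hs2 : rnorm (phi (x - star E ** x)) <= e.
    have -> : x - star E ** x = star (x - x ** E) by rewrite starB starM xs.
    apply: le_trans (hM _) _; rewrite rnorm_star.
    apply: (@le_trans _ _ ((M + 1) * rnorm (x - x ** E))).
      by rewrite ler_wpM2r ?rnorm_ge0// lerDl.
    by rewrite mulrC -ler_pdivlMr.
  move: (le_trans (Im_le_rnorm _) hs1) (le_trans (Im_le_rnorm _) hs2).
  rewrite !(traceB phiT) h1; case: (phi (x ** E)) => p q; case: (phi x) => p' q' /=.
  by rewrite !ler_norml => /andP[? ?] /andP[? ?]; apply/andP; split; lra.
have := sa (a + star a); rewrite starD starK addrC => /(_ erefl).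
have := sa ((Complex 0 1) *: (a - star a)); rewrite starZ starB starK.
rewrite conj_imag scaleNr -scalerN opprB => /(_ erefl).
rewrite (traceZ phiT) (traceB phiT) (traceD phiT).
case: (phi a) => p q; case: (phi (star a)) => p' q' /= h1 h2.
by apply: complex_eqP => /=; lra.
Qed.

Variable M : R.
Hypothesis M0 : 0 <= M.
Hypothesis phiM : forall a, rnorm (phi a) <= M * rnorm a.

Lemma hs_le_rnorm a : hs phi a <= Num.sqrt M * rnorm a.
Proof.
rewrite -ler_sqr ?nnegrE ?mulr_ge0 ?sqrtr_ge0 ?hs_ge0 ?rnorm_ge0// exprMn.
rewrite (hs_sqr phiT) sqr_sqrtr// -rnorm_star2.
exact: le_trans (le_trans (ler_norm _) (Re_le_rnorm _)) (phiM _).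
Qed.

(** Cauchy-Schwarz against the unit, for which the [E] of [approx_unit] stands in; its norm bound is
    the constant 1 + e. *)
Lemma trace_le_hs a : rnorm (phi a) <= (1 + expR 1) * Num.sqrt M * hs phi a.
Proof.
set K := 1 + expR 1; have K0 : 0 < K by rewrite addr_gt0 ?expR_gt0.
have sa x : star x = x -> rnorm (phi x) <= K * Num.sqrt M * hs phi x.
  move=> xs; apply/ler_addgt0Pr => e e0.
  have M1 : 0 < M + 1 by rewrite ltr_wpDl.
  have [E EK xE] := approx_unit xs (divr_gt0 e0 M1).
  have -> : phi x = phi (x ** E) + phi (x - x ** E) by rewrite -(traceD phiT) addrC subrK.
  apply: le_trans (rnormD _ _) _; apply: lerD.
    apply: le_trans (rnorm_mul_le phiT _ _) _; rewrite mulrC ler_wpM2r ?hs_ge0//.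
    by apply: le_trans (hs_le_rnorm _) _; rewrite mulrC ler_wpM2r ?sqrtr_ge0.
  apply: le_trans (phiM _) _; apply: (@le_trans _ _ ((M + 1) * rnorm (x - x ** E))).
    by rewrite ler_wpM2r ?rnorm_ge0// lerDl.
  by rewrite mulrC -ler_pdivlMr.
have [u u1 uE] := rotate_real (phi a).
rewrite -uE -(traceZ phiT) -[hs phi a]mul1r -u1 -(hsZ phiT).
move: (u *: a) => {u u1 uE}a.
(* After the rotation only the real part of [phi] matters, and it depends only on the selfadjoint
   part of [a]. *)
pose b := (2^-1)%:C *: (a + star a).
have bs : star b = b by rewrite /b starZ starD starK addrC conj_real.
have -> : complex.Re (phi a) = complex.Re (phi b).
  rewrite /b (traceZ phiT) (traceD phiT) trace_star.
  by case: (phi a) => p q /=; rewrite mul0r subr0; field.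
apply: le_trans (ler_norm _) _; apply: le_trans (Re_le_rnorm _) _.
apply: le_trans (sa _ bs) _.
apply: ler_wpM2l; first by rewrite mulr_ge0 ?sqrtr_ge0// ltW.
rewrite (hsZ phiT) rnorm_real ger0_norm ?invr_ge0// mulrC ler_pdivrMr//.
by apply: le_trans (hsD phiT _ _) _; rewrite (hs_star phiT) mulr_natr mulr2n.
Qed.

End AlmostUnitary.

(** * Limits of bounded complex sequences along an ultrafilter *)

Section UltraLimits.
Variables (R : realType) (F : set_system nat).
Context {FU : UltraFilter F}.
Implicit Types (f g : nat -> R[i]) (u v : nat -> R).

Definition ulim u : R := lim (u n @[n --> F]).

Lemma ulim_cvg u (M : R) : (forall n, `|u n| <= M) -> u n @[n --> F] --> ulim u.
Proof.
move=> uM; have hc : cvg ((u n + M) @[n --> F]).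
  apply: (@ultra_is_cvg R F FU _ (M + M)) => n.
  by have := uM n; rewrite ler_norml => /andP[? ?]; apply/andP; split; lra.
have : cvg (u n @[n --> F]) => //.
have -> : u = (fun n => (u n + M) - M) by apply: funext => n; rewrite addrK.
by apply: is_cvgB => //; exact: is_cvg_cst.
Qed.

Lemma ulim_eq u (l : R) : u n @[n --> F] --> l -> ulim u = l.
Proof. by move/(cvg_lim (@norm_hausdorff _ _)). Qed.

Lemma cvg_le_near u v (l l' : R) : u n @[n --> F] --> l -> v n @[n --> F] --> l' ->
  (\forall n \near F, u n <= v n) -> l <= l'.
Proof.
move=> ul vl uv; rewrite -(ulim_eq vl) -(ulim_eq ul).
by apply: ler_lim => //; [apply/cvg_ex; exists l|apply/cvg_ex; exists l'].
Qed.

Definition cbounded f := exists M : R, forall n, rnorm (f n) <= M.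

(** Taken coordinatewise, because existence of the limit comes from compactness of real segments. *)
Definition clim f : R[i] :=
  Complex (ulim (fun n => complex.Re (f n))) (ulim (fun n => complex.Im (f n))).

Lemma clim_Re f : cbounded f -> complex.Re (f n) @[n --> F] --> complex.Re (clim f).
Proof. by move=> [M fM]; apply: (@ulim_cvg _ M) => n; apply: le_trans (Re_le_rnorm _) _. Qed.

Lemma clim_Im f : cbounded f -> complex.Im (f n) @[n --> F] --> complex.Im (clim f).
Proof. by move=> [M fM]; apply: (@ulim_cvg _ M) => n; apply: le_trans (Im_le_rnorm _) _. Qed.

Lemma clim_linear (k : R[i]) f g : cbounded f -> cbounded g ->
  clim (fun n => k * f n + g n) = k * clim f + clim g.
Proof.
move=> fb gb; have fR := clim_Re fb; have fI := clim_Im fb.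
have gR := clim_Re gb; have gI := clim_Im gb.
apply: complex_eqP; rewrite ?cReD ?cImD ?cReM ?cImM; apply: ulim_eq.
  rewrite (_ : (fun n => _) = (fun n => complex.Re k * complex.Re (f n) -
    complex.Im k * complex.Im (f n) + complex.Re (g n))); last first.
    by apply: funext => n; rewrite cReD cReM.
  apply: cvgD => //; apply: cvgB; apply: cvgM => //; exact: cvg_cst.
rewrite (_ : (fun n => _) = (fun n => complex.Re k * complex.Im (f n) +
    complex.Im k * complex.Re (f n) + complex.Im (g n))); last first.
  by apply: funext => n; rewrite cImD cImM.
apply: cvgD => //; apply: cvgD; apply: cvgM => //; exact: cvg_cst.
Qed.

Lemma clim_ge0 f : cbounded f -> (forall n, 0 <= f n) -> 0 <= clim f.
Proof.
move=> fb f0; apply/complex_ge0P; split.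
  apply: (cvg_le_near (cvg_cst (0 : R)) (clim_Re fb)); apply: filterE => n.
  by have /complex_ge0P[] := f0 n.
apply: ulim_eq; apply: cvg_near_cst; apply: filterE => n.
by have /complex_ge0P[] := f0 n.
Qed.

(** The factor 2 arises from bounding the real and the imaginary part separately; it is harmless for
    boundedness. *)
Lemma rnorm_clim_le f u (l : R) : cbounded f -> (forall n, rnorm (f n) <= u n) ->
  u n @[n --> F] --> l -> rnorm (clim f) <= l + l.
Proof.
move=> fb fu ul; apply: le_trans (rnorm_le_ReIm _) _; apply: lerD.
  apply: (cvg_le_near (cvg_norm (clim_Re fb)) ul); apply: filterE => n.
  exact: le_trans (Re_le_rnorm _) _.
apply: (cvg_le_near (cvg_norm (clim_Im fb)) ul); apply: filterE => n.
exact: le_trans (Im_le_rnorm _) _.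
Qed.

Lemma clim_eq f (z : R[i]) u : (forall n, rnorm (f n - z) <= u n) ->
  u n @[n --> F] --> 0 -> clim f = z.
Proof.
move=> fu u0; apply: complex_eqP; apply: ulim_eq.
  have -> : (fun n => complex.Re (f n)) = (fun n => complex.Re (f n - z) + complex.Re z).
    by apply: funext => n; rewrite cReD cReN subrK.
  rewrite -[X in _ --> X]add0r; apply: cvgD; last exact: cvg_cst.
  apply/norm_cvg0P; apply: (@squeeze_cvgr _ _ _ _ (fun=> 0) u) => //.
    by apply: filterE => n; rewrite normr_ge0 (le_trans (Re_le_rnorm _)).
  exact: cvg_cst.
have -> : (fun n => complex.Im (f n)) = (fun n => complex.Im (f n - z) + complex.Im z).
  by apply: funext => n; rewrite cImD cImN subrK.
rewrite -[X in _ --> X]add0r; apply: cvgD; last exact: cvg_cst.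
apply/norm_cvg0P; apply: (@squeeze_cvgr _ _ _ _ (fun=> 0) u) => //.
  by apply: filterE => n; rewrite normr_ge0 (le_trans (Im_le_rnorm _)).
exact: cvg_cst.
Qed.

End UltraLimits.

(** * Sums, multiples and differences of traces; domination and disjointness *)

Section Order.
Variables (R : realType) (A : cstarAlgType R).
Implicit Types (phi psi theta : A -> R[i]).

Definition dominated theta phi := forall a, ip theta a a <= ip phi a a.

(** Mutual singularity, expressed inside the cone of traces. *)
Definition disjoint_traces phi psi := forall theta, is_trace theta ->
  dominated theta phi -> dominated theta psi -> forall a, theta a = 0.

Lemma is_trace0 : is_trace (fun _ : A => 0 : R[i]).
Proof.
split=> //; first by move=> k a b; rewrite mulr0 addr0.
by exists 0 => a; rewrite rnorm0 mul0r.
Qed.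

Lemma is_traceD phi psi : is_trace phi -> is_trace psi -> is_trace (fun a => phi a + psi a).
Proof.
move=> h1 h2; split.
- by move=> k a b; rewrite (trace_linear h1) (trace_linear h2) mulrDr addrACA.
- have [M _ hM] := trace_bound h1; have [N _ hN] := trace_bound h2.
  by exists (M + N) => a; apply: le_trans (rnormD _ _) _; rewrite mulrDl lerD.
- by move=> a; rewrite addr_ge0// ?(trace_positive h1) ?(trace_positive h2).
- by move=> a b; rewrite (trace_comm h1) (trace_comm h2).
Qed.

Lemma is_traceZ (t : R) phi : 0 <= t -> is_trace phi -> is_trace (fun a => t%:C * phi a).
Proof.
move=> t0 h; split.
- by move=> k a b; rewrite (trace_linear h) mulrDr mulrCA.
- have [M _ hM] := trace_bound h; exists (t * M) => a.
  by rewrite rnormCM rnorm_real ger0_norm// -mulrA ler_wpM2l.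
- by move=> a; rewrite mulr_ge0 ?ler0c// (trace_positive h).
- by move=> a b; rewrite (trace_comm h).
Qed.

Lemma is_traceB phi psi : is_trace phi -> is_trace psi -> dominated psi phi ->
  is_trace (fun a => phi a - psi a).
Proof.
move=> h1 h2 d; split.
- by move=> k a b; rewrite (trace_linear h1) (trace_linear h2) opprD addrACA mulrBr.
- have [M _ hM] := trace_bound h1; have [N _ hN] := trace_bound h2.
  by exists (M + N) => a; apply: le_trans (rnormD _ _) _; rewrite rnormN mulrDl lerD.
- by move=> a; rewrite (trace_sqE h1) (trace_sqE h2) -rmorphB ler0c subr_ge0 d.
- by move=> a b; rewrite (trace_comm h1) (trace_comm h2).
Qed.

Lemma ip_traceD phi psi a b :
  ip (fun c => phi c + psi c) a b = ip phi a b + ip psi a b.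
Proof. by rewrite /ip cReD. Qed.

Lemma dominatedDl phi psi : is_trace psi -> dominated phi (fun a => phi a + psi a).
Proof. by move=> h a; rewrite ip_traceD lerDl ip_ge0. Qed.

Lemma dominatedDr phi psi : is_trace psi -> dominated phi (fun a => psi a + phi a).
Proof. by move=> h a; rewrite ip_traceD lerDr ip_ge0. Qed.

Lemma dominated_hs phi psi a : dominated phi psi -> hs phi a <= hs psi a.
Proof. by move=> d; apply: ler_wsqrtr. Qed.

Lemma disjoint_traces_sym phi psi : disjoint_traces phi psi -> disjoint_traces psi phi.
Proof. by move=> d theta tT t1 t2; exact: d. Qed.

Lemma disjoint_traces_dominated phi phi' psi :
  dominated phi' phi -> disjoint_traces phi psi -> disjoint_traces phi' psi.
Proof. by move=> h d theta tT t1 t2; apply: d => // a; exact: le_trans (t1 a) (h a). Qed.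

End Order.

(** * Approximate Radon-Nikodym densities of traces *)

Section RadonNikodym.
Variables (R : realType) (A : cstarAlgType R).
Variables phi psi : A -> R[i].
Hypotheses (phiT : is_trace phi) (psiT : is_trace psi).
Implicit Types (a b x y : A).

Let tau a := phi a + psi a.
Let tauT : is_trace tau := is_traceD phiT psiT.
Let ip_tau a b : ip tau a b = ip phi a b + ip psi a b.
Proof. exact: ip_traceD. Qed.

(* Almost minimisers of tau(x^2) - 2 Re phi(x): in the completion of [A] they
   converge to the density of [phi] with respect to [tau = phi + psi]. *)
Lemma almost_density : exists B : R, forall e : R, 0 < e ->
  exists x : A, [/\ star x = x, hs tau x <= B &
    forall y, `|complex.Re (tau (x ** y)) - complex.Re (phi y)| <= e * hs tau y].
Proof.
have [M M0 phiM] := trace_bound phiT.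
pose C := (1 + expR 1) * Num.sqrt M.
have C0 : 0 <= C by rewrite mulr_ge0 ?sqrtr_ge0// addr_ge0 ?expR_ge0.
have phiC x : complex.Re (phi x) <= C * hs tau x.
  apply: le_trans (le_trans (ler_norm _) (Re_le_rnorm _)) _.
  apply: le_trans (trace_le_hs phiT M0 phiM x) _; apply: ler_wpM2l => //.
  exact/dominated_hs/dominatedDl.
pose G x := ip tau x x - 2 * complex.Re (phi x).
pose S := [set G x | x in [set x | star x = x]].
have G0 : S 0.
  exists 0; first by rewrite /= star0.
  by rewrite /G /ip cmulr0 (trace0 tauT) (trace0 phiT) /= mulr0 subr0.
(* Completing the square: t^2 - 2 C t >= - C^2. *)
have lbS : lbound S (- C ^+ 2).
  move=> _ [x _ <-]; rewrite /G -(hs_sqr tauT).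
  have := phiC x; have := sqr_ge0 (hs tau x - C); rewrite sqrrB; lra.
have hS : has_inf S by split; [exists 0|exists (- C ^+ 2)].
exists (2 * C + 1) => e e0.
(* Closeness [1] to the infimum gives the bound 2 C + 1 on [hs tau x]; closeness [e ^+ 2] gives the
   error [e]. *)
have d0 : 0 < Num.min (e ^+ 2) 1 by rewrite lt_min ltr01 andbT exprn_gt0.
have [_ [x /= xs <-]] := inf_adherent d0 hS; rewrite -ltrBlDl lt_min => /andP[xe x1].
have g0 : inf S <= 0 by apply: ge_inf => //; exists (- C ^+ 2).
exists x; split=> //.
  have h : hs tau x ^+ 2 - 2 * (C * hs tau x) < 1.
    have := phiC x; rewrite (hs_sqr tauT); move: x1; rewrite /G; lra.
  rewrite leNgt; apply/negP => lt.
  suff : 1 < hs tau x * (hs tau x - 2 * C) by rewrite -/(_ - _) mulrBr; lra.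
  by apply: mulr_egt1; lra.
move=> y; pose a := (2^-1)%:C *: (y + star y).
have as_ : star a = a by rewrite /a starZ starD starK addrC conj_real.
have hsa : hs tau a <= hs tau y.
  rewrite (hsZ tauT) rnorm_real ger0_norm ?invr_ge0// mulrC ler_pdivrMr//.
  by apply: le_trans (hsD tauT _ _) _; rewrite (hs_star tauT) mulr_natr mulr2n.
(* As [x] is selfadjoint, both real parts depend only on the selfadjoint part [a] of [y], an
   admissible direction of variation. *)
have -> : complex.Re (tau (x ** y)) - complex.Re (phi y) =
    ip tau x a - complex.Re (phi a).
  have -> : complex.Re (tau (x ** y)) = ip tau x y by rewrite /ip xs.
  have e1 : ip tau x (star y) = ip tau x y by rewrite -{1}xs (ip_star tauT) (ipC tauT).
  rewrite /a (ipZr tauT) (ipDr tauT) e1 (traceZ phiT) (traceD phiT) (trace_star phiT).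
  by case: (phi y) => p q /=; rewrite mul0r subr0; field.
clearbody a; set w := _ - _.
(* [w] is half the derivative of [G] at [x] in direction [a]; along this line [G - inf S] is a
   nonnegative quadratic polynomial. *)
have : w ^+ 2 <= (G x - inf S) * ip tau a a.
  apply: quadratic_ge0; rewrite ?(ip_ge0 tauT)//.
    by rewrite subr_ge0; apply: ge_inf; [exists (- C ^+ 2)|exists x].
  move=> t; have : inf S <= G (x + t%:C *: a).
    apply: ge_inf; first by exists (- C ^+ 2).
    by exists (x + t%:C *: a) => //=; rewrite starD starZ conj_real xs as_.
  rewrite /G (ipDl tauT) !(ipDr tauT) !(ipZl tauT) !(ipZr tauT) (ipC tauT a x).
  rewrite (traceD phiT) (traceZ phiT) cReD cReM /= /w; lra.
rewrite -(hs_sqr tauT) => hw.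
rewrite -ler_sqr ?nnegrE ?mulr_ge0 ?hs_ge0 ?(ltW e0)// real_normK ?num_real//.
apply: le_trans hw _; rewrite exprMn; apply: ler_pM.
- by rewrite subr_ge0; apply: ge_inf; [exists (- C ^+ 2)|exists x].
- exact: sqr_ge0.
- exact: ltW.
- by rewrite ler_sqr ?nnegrE ?hs_ge0.
Qed.

Section Estimates.
Variables (x : A) (e B : R).
Hypotheses (e0 : 0 <= e) (xs : star x = x) (xB : hs tau x <= B).
Hypothesis xe :
  forall y, `|complex.Re (tau (x ** y)) - complex.Re (phi y)| <= e * hs tau y.

Let D y := hs tau (y ** star y) + B * rnorm (y ** star y).

(** Tests [xe] at [y y^*] and at [x y y^*], moving [y^*] around by the trace property. The two
    summands of [D] bound the seminorms of these test elements. *)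
Let errors y : exists e1 e2 : R, [/\ `|e1| + `|e2| <= e * D y,
  ip tau y (x ** y) = ip phi y y + e1 &
  ip tau (x ** y) (x ** y) = ip phi y (x ** y) + e2].
Proof.
pose b := y ** star y.
have L1 chi : is_trace chi -> complex.Re (chi (x ** b)) = ip chi y (x ** y).
  by move=> h; rewrite /ip /b cmulA (trace_comm h).
have L2 : complex.Re (tau (x ** (x ** b))) = ip tau (x ** y) (x ** y).
  have -> : x ** (x ** b) = x ** (x ** y) ** star y by rewrite /b !cmulA.
  by rewrite (trace_comm tauT) /ip starM xs cmulA.
exists (complex.Re (tau (x ** b)) - complex.Re (phi b)).
exists (complex.Re (tau (x ** (x ** b))) - complex.Re (phi (x ** b))); split.
- rewrite /D mulrDr; apply: lerD; first exact: xe.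
  apply: le_trans (xe _) _; apply: ler_wpM2l => //.
  by apply: le_trans (hs_mulr tauT _ _) _; rewrite ler_wpM2r ?rnorm_ge0.
- by rewrite L1// addrC [ip phi y y]/ip (trace_comm phiT) subrK.
- by rewrite L2 L1// addrC subrK.
Qed.

Let expand chi y : is_trace chi -> ip chi (x ** y - y) (x ** y - y) =
  ip chi y y - 2 * ip chi y (x ** y) + ip chi (x ** y) (x ** y).
Proof.
move=> h; rewrite (ipDl h) !(ipDr h) !(ipNl h) !(ipNr h) (ipC h (x ** y) y); ring.
Qed.

(** For an exact density h of [phi], that of [psi] is 1 - h, and the two sides agree because h (1 -
    h) = h (1 - h)^2 + (1 - h) h^2. *)
Lemma density_defect y :
  `|ip psi y (x ** y) -
    (ip phi (x ** y - y) (x ** y - y) + ip psi (x ** y) (x ** y))| <= e * D y.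
Proof.
have [e1 [e2 [eD h1 h2]]] := errors y; apply: le_trans eD; rewrite (expand _ phiT).
have -> : ip psi y (x ** y) - (ip phi y y - 2 * ip phi y (x ** y) +
  ip phi (x ** y) (x ** y) + ip psi (x ** y) (x ** y)) = e1 - e2.
  by move: h1 h2; rewrite !ip_tau; lra.
exact: ler_normB.
Qed.

(** The inequality h (1 - h) <= 1 - h, from (1 - h)^2 >= 0. Likewise [density_le_phi] is h (1 - h)
    <= h, from h^2 >= 0. *)
Lemma density_le_psi y : ip psi y (x ** y) <= ip psi y y + e * D y.
Proof.
have [e1 [e2 [eD h1 h2]]] := errors y.
have := ip_ge0 tauT (x ** y - y); rewrite (expand _ tauT).
move: (ler_norm (- e1)) (ler_norm e2) eD h1 h2; rewrite !ip_tau normrN; lra.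
Qed.

Lemma density_le_phi y : ip psi y (x ** y) <= ip phi y y + e * D y.
Proof.
have [e1 [e2 [eD h1 h2]]] := errors y.
have := ip_ge0 tauT (x ** y).
move: (ler_norm e1) (ler_norm e2) eD h1 h2; rewrite !ip_tau; lra.
Qed.

(** The density of a trace is central: for the commutator [w] and [z := w a^* - a^* w], [phi z]
    vanishes while [tau (x ** z)] has real part [hs tau w ^+ 2]. *)
Lemma density_commutes a : hs tau (x ** a - a ** x) <= e * (rnorm a + rnorm a).
Proof.
set w := x ** a - a ** x.
have [w0|w0] := leP (hs tau w) 0.
  by apply: le_trans w0 _; rewrite mulr_ge0// addr_ge0 ?rnorm_ge0.
pose z := w ** star a - star a ** w.
have zE : hs tau w ^+ 2 = complex.Re (tau (x ** z)).
  rewrite (hs_sqr tauT) /ip {1}/w starB !starM xs cmulBl (traceB tauT).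
  rewrite /z cmulBr (traceB tauT) -[star a ** x ** w]cmulA (trace_comm tauT (star a)).
  by rewrite !cmulA.
have phiz : complex.Re (phi z) = 0.
  by rewrite /z (traceB phiT) (trace_comm phiT) subrr.
have := xe z; rewrite -zE phiz subr0 => /(le_trans (ler_norm _)) h.
rewrite -(ler_pM2r w0) -expr2; apply: le_trans h _; rewrite -mulrA ler_wpM2l//.
apply: le_trans (hsB tauT _ _) _; rewrite mulrDl; apply: lerD.
  by apply: le_trans (hs_mulr tauT _ _) _; rewrite rnorm_star mulrC.
by apply: le_trans (hs_mull tauT _ _) _; rewrite rnorm_star.
Qed.

End Estimates.

Lemma disjoint_density (s : seq A) (e : R) : disjoint_traces phi psi -> 0 < e ->
  exists2 x : A, star x = x &
    forall y, y \in s -> hs phi (x ** y - y) <= e /\ hs psi (x ** y) <= e.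
Proof.
move=> dis e0; have [B hB] := almost_density.
have /choice[x xP] : forall n : nat, exists x : A, [/\ star x = x, hs tau x <= B &
    forall y, `|complex.Re (tau (x ** y)) - complex.Re (phi y)| <= n.+1%:R^-1 * hs tau y].
  by move=> n; apply: hB; rewrite invr_gt0 ltr0n.
(* An auxiliary ultrafilter, unrelated to the one of the ultrapower, which serves to define the
   limit functional [theta]. *)
have [F [FU Foo]] := ultraFilterLemma (@eventually_filter).
have xs n : star (x n) = x n by have [] := xP n.
have xB n : hs tau (x n) <= B by have [] := xP n.
have xe n := let: And3 _ _ h := xP n in h.
pose h n : R := n.+1%:R^-1.
have h_ge0 n : 0 <= h n by rewrite invr_ge0.
have h0 : h n @[n --> F] --> 0 by move=> S /(@cvg_harmonic R); exact: Foo.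
have hc (c : R) : h n * c @[n --> F] --> 0.
  by rewrite -[0](mul0r c); apply: cvgM => //; exact: cvg_cst.
pose D y := hs tau (y ** star y) + B * rnorm (y ** star y).
have psi_le a : hs psi a <= hs tau a by exact/dominated_hs/dominatedDr.
have [M M0 psiM] := trace_bound psiT.
have bnd y n : rnorm (psi (x n ** y)) <= B * Num.sqrt M * rnorm y.
  apply: le_trans (rnorm_mul_le psiT _ _) _; rewrite -mulrA.
  apply: ler_pM; rewrite ?hs_ge0//; first exact: le_trans (psi_le _) _.
  exact: hs_le_rnorm.
have cb y : cbounded (fun n => psi (x n ** y)) by exists (B * Num.sqrt M * rnorm y).
pose theta y := clim F (fun n => psi (x n ** y)).
have psi_re n y : psi (x n ** (y ** star y)) = (ip psi y (x n ** y))%:C.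
  have -> : ip psi y (x n ** y) = complex.Re (psi (x n ** (y ** star y))).
    by rewrite /ip (trace_comm psiT) !cmulA.
  apply: complex_eqP => //=.
  have := trace_star psiT (x n ** (y ** star y)); rewrite !starM starK xs.
  rewrite (trace_comm psiT); case: (psi _) => p q [] /=; lra.
have thetaE y : ip psi y (x n ** y) @[n --> F] --> complex.Re (theta (y ** star y)).
  have -> : (fun n => ip psi y (x n ** y)) =
      (fun n => complex.Re (psi (x n ** (y ** star y)))).
    by apply: funext => n; rewrite psi_re.
  exact: clim_Re (cb (y ** star y)).
have P n y := density_defect (h_ge0 n) (xs n) (xB n) (xe n) y.
(* Positivity comes from [density_defect], the trace property from [density_commutes]. *)
have thetaT : is_trace theta.
  split.
  - move=> k a b; rewrite /theta -clim_linear//; congr (clim F _).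
    by apply: funext => n; rewrite cmulDr -cscaleAr (traceD psiT) (traceZ psiT).
  - exists (B * Num.sqrt M + B * Num.sqrt M) => a; rewrite mulrDl.
    by apply: (rnorm_clim_le (cb a) (bnd a)); exact: cvg_cst.
  - move=> a; apply/complex_ge0P; split.
      have := thetaE (star a); rewrite starK => tE.
      apply: (@cvg_le_near _ F _ (fun n => - (h n * D (star a))) _ 0) tE _.
        by rewrite -oppr0; apply: cvgN; exact: hc.
      apply: filterE => n; have := P n (star a); rewrite ler_norml => /andP[+ _].
      move: (ip_ge0 phiT (x n ** star a - star a)) (ip_ge0 psiT (x n ** star a)).
      rewrite -/(h n) -/(D _); lra.
    apply: ulim_eq; apply: cvg_near_cst; apply: filterE => n.
    by have := psi_re n (star a); rewrite starK => ->.
  - move=> a b; apply/eqP; rewrite -subr_eq0; apply/eqP.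
    have -> : theta (a ** b) - theta (b ** a) =
        clim F (fun n => -1 * psi (x n ** (b ** a)) + psi (x n ** (a ** b))).
      by rewrite clim_linear// mulN1r addrC.
    apply: (@clim_eq _ F _ _ _ (fun n => h n * ((rnorm a + rnorm a) * hs psi b))); last exact: hc.
    move=> n; rewrite subr0 mulN1r addrC (cmulA _ b) (trace_comm psiT _ a) !cmulA -(traceB psiT).
    have -> : x n ** a ** b - a ** x n ** b = (x n ** a - a ** x n) ** b by rewrite cmulBl.
    apply: le_trans (rnorm_mul_le psiT _ _) _; rewrite mulrA ler_wpM2r ?hs_ge0//.
    apply: le_trans (psi_le _) _.
    exact: density_commutes (h_ge0 n) (xs n) (xe n) _.
have dpsi : dominated theta psi.
  move=> a; have := thetaE (star a); rewrite starK => tE.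
  apply: (@cvg_le_near _ F _ _ (fun n => ip psi a a + h n * D (star a))) tE _ _.
    by rewrite -[X in _ --> X]addr0; apply: cvgD; [exact: cvg_cst|exact: hc].
  apply: filterE => n; rewrite -(ip_star psiT a a).
  exact: density_le_psi (h_ge0 n) (xs n) (xB n) (xe n) _.
have dphi : dominated theta phi.
  move=> a; have := thetaE (star a); rewrite starK => tE.
  apply: (@cvg_le_near _ F _ _ (fun n => ip phi a a + h n * D (star a))) tE _ _.
    by rewrite -[X in _ --> X]addr0; apply: cvgD; [exact: cvg_cst|exact: hc].
  apply: filterE => n; rewrite -(ip_star phiT a a).
  exact: density_le_phi (h_ge0 n) (xs n) (xB n) (xe n) _.
have theta0 := dis _ thetaT dphi dpsi.
(* Since [theta] vanishes, [density_defect] forces both of its nonnegative terms to be small. *)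
have lim0 y : \forall n \near F, hs phi (x n ** y - y) <= e /\ hs psi (x n ** y) <= e.
  have c0 : ip psi y (x n ** y) + h n * D y @[n --> F] --> 0.
    have := thetaE y; rewrite theta0 /= => tE.
    by rewrite -[X in _ --> X](addr0 0); exact: (cvgD tE (hc (D y))).
  have near1 : \forall n \near F, ip psi y (x n ** y) + h n * D y < e ^+ 2.
    by apply: (@cvgr_lt _ _ _ _ _ _ c0); exact: exprn_gt0.
  apply: filterS near1 => n hn.
  have := P n y; rewrite ler_norml -/(h n) -/(D _) => /andP[Pn _].
  have p1 := ip_ge0 phiT (x n ** y - y); have p2 := ip_ge0 psiT (x n ** y).
  split; rewrite -ler_sqr ?nnegrE ?hs_ge0 ?(ltW e0)// hs_sqr//; lra.
have /filter_ex[n hn] : \forall n \near F, forall y, y \in s ->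
    hs phi (x n ** y - y) <= e /\ hs psi (x n ** y) <= e.
  elim: s => [|y s IH]; first by apply: filterE.
  apply: filterS2 (lim0 y) IH => n h1 h2 z; rewrite inE => /predU1P[->//|]; exact: h2.
by exists (x n).
Qed.

End RadonNikodym.

(** * Contractions separating disjoint traces *)

Section Contractions.
Variables (R : realType) (A : cstarAlgType R).
Implicit Types (phi psi theta : A -> R[i]) (a b x y f : A).

(* [r] is tan(pi / N) with N = 4 * 2 ^ j, built by the half-angle formula. *)
Lemma half_angle j : exists r l : R,
  [/\ 0 < r, r <= 2^-1 ^+ j, 1 <= l & (Complex 1 r) ^+ (4 * 2 ^ j) = (- l)%:C].
Proof.
elim: j => [|j [r [l [r0 rj l1 rl]]]].
  (* tan(pi / 4) = 1 and (1 + i)^4 = -4. *)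
  exists 1, 4; split=> //; first by rewrite ler1n.
  by rewrite muln1; apply: complex_eqP; rewrite !exprS expr0 /=; ring.
pose s := Num.sqrt (1 + r ^+ 2).
have s2 : s ^+ 2 = 1 + r ^+ 2 by rewrite sqr_sqrtr// addr_ge0// sqr_ge0.
have s1 : 1 <= s by rewrite -[1]sqrtr1 ler_wsqrtr// lerDl sqr_ge0.
have s0 : 0 < 1 + s by lra.
(* The tangent of half the angle; (1 + i r')^2 is the real multiple [c] of 1 + i r. *)
pose r' := r / (1 + s); pose c := 2 / (1 + s).
have cE : 1 - r' ^+ 2 = c.
  have -> : r' ^+ 2 = (s ^+ 2 - 1) / (1 + s) ^+ 2 by rewrite s2 /r'; field; rewrite gt_eqF.
  by rewrite /c; field; rewrite gt_eqF.
have sq : (Complex 1 r') ^+ 2 = c%:C * Complex 1 r.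
  rewrite expr2; apply: complex_eqP => /=.
    by rewrite !mul0r subr0 !mulr1 -expr2.
  by rewrite mulr1 mul0r addr0 mul1r /c /r'; field; rewrite gt_eqF.
have pw : (Complex 1 r') ^+ (4 * 2 ^ j.+1) = (- (c ^+ (4 * 2 ^ j) * l))%:C.
  rewrite expnS mulnCA exprM sq exprMn rl -rmorphXn -rmorphM/=; congr _%:C; ring.
exists r', (c ^+ (4 * 2 ^ j) * l); split=> //.
- by rewrite divr_gt0.
- rewrite exprS mulrC; apply: ler_pM => //; first exact: ltW.
    by rewrite invr_ge0 ltW.
  by rewrite lef_pV2 ?posrE//; lra.
- have c0 : 0 <= c by rewrite divr_ge0 ?ltW.
  rewrite -(@ger0_norm _ (_ * l)); last by rewrite mulr_ge0 ?exprn_ge0//; lra.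
  rewrite -normrN -rnorm_real -pw rnormCX exprn_ege1//.
  by have := Re_le_rnorm (Complex 1 r'); rewrite /= normr1.
Qed.

Lemma hs_bounded_seq phi (s : seq A) : exists2 H : R, 0 < H & forall y, y \in s -> hs phi y <= H.
Proof.
elim: s => [|y s [H H0 IH]]; first by exists 1.
exists (H + hs phi y); first by rewrite ltr_wpDr// hs_ge0.
by move=> z; rewrite inE => /predU1P[->|/IH h]; [rewrite lerDr ltW|rewrite ler_wpDr// hs_ge0].
Qed.

(** The polynomial takes the value 1 at x = 1 and 0 at x = 0, so it inherits the behaviour of the
    [x] of [disjoint_density], up to a factor independent of the norm of [x]. That norm only
    determines how large N must be. *)
Lemma disjoint_contraction phi psi (s : seq A) (e : R) :
  is_trace phi -> is_trace psi -> disjoint_traces phi psi -> 0 < e ->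
  exists2 f : A, rnorm f <= 1 &
    forall y, y \in s -> hs phi (f ** y - y) <= e /\ hs psi (f ** y) <= e.
Proof.
move=> phiT psiT dis e0; pose e' := e / 8; have e'0 : 0 < e' by rewrite divr_gt0.
have [x xs xP] := disjoint_density phiT psiT s dis e'0.
have [H H0 HP] := hs_bounded_seq phi s.
(* [d] will bound the excess of the norm over 1; rescaling then costs at most [d * H <= e / 2] on
   [s]. *)
pose d := Num.min 1 (e / (2 * H)).
have d0 : 0 < d by rewrite lt_min ltr01 divr_gt0// mulr_gt0.
have d1 : d <= 1 by rewrite ge_min lexx.
have dH : d * H <= e / 2.
  have -> : e / 2 = e / (2 * H) * H by field; rewrite gt_eqF.
  by rewrite ler_pM2r// ge_min lexx orbT.
(* The added 1 gives [T >= 1], so that [g] below bounds the modulus of 1 + i r too. *)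
pose T := rnorm x + 1; have T0 : 0 < T by rewrite ltr_wpDl ?rnorm_ge0.
have [j jP] : exists j, 4 * T ^+ 2 * 2^-1 ^+ j < d / (1 + d).
  have cv : 4 * T ^+ 2 * 2^-1 ^+ j @[j --> \oo] --> (0 : R).
    rewrite -[X in _ --> X](mulr0 (4 * T ^+ 2)); apply: cvgM; first exact: cvg_cst.
    by apply: cvg_expr; rewrite ger0_norm ?invr_ge0// invf_lt1 ?ltr1n.
  have dd : 0 < d / (1 + d) by rewrite divr_gt0// addr_gt0.
  have [K _ /(_ K (leqnn K))] := @cvgr_lt _ _ _ _ _ _ cv _ dd.
  by exists K.
have [r [l [r0 rj l1 rl]]] := half_angle j.
set N := (4 * 2 ^ j)%N in rl.
have NE : N%:R = 4 * 2 ^+ j :> R by rewrite natrM natrX.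
have Nr : N%:R * r <= 4.
  apply: (@le_trans _ _ (N%:R * 2^-1 ^+ j)); first by rewrite ler_wpM2l.
  by rewrite NE -mulrA -exprMn divff ?expr1n ?mulr1// pnatr_eq0.
pose g := 1 + (r * T) ^+ 2.
have g1 : 1 <= g by rewrite lerDl sqr_ge0.
(* From N r <= 4 and r <= 2^-j, N (r T)^2 <= 4 T^2 2^-j < d / (1 + d), and exp (d / (1 + d)) <= 1 +
   d because exp (- t) >= 1 - t. *)
have gN : g ^+ N <= 1 + d.
  apply: (@le_trans _ _ (expR (N%:R * (r * T) ^+ 2))).
    by rewrite mulrC expRM_natr lerXn2r ?nnegrE ?expR_ge0 ?expR_ge1Dx//; lra.
  set t := N%:R * _.
  have td : t < d / (1 + d).
    apply: le_lt_trans jP; rewrite /t exprMn.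
    have -> : N%:R * (r ^+ 2 * T ^+ 2) = (N%:R * r) * T ^+ 2 * r by ring.
    have Nr0 : 0 <= N%:R * r by rewrite mulr_ge0// ltW.
    apply: ler_pM => //; first by rewrite mulr_ge0// sqr_ge0.
      exact: ltW.
    by rewrite ler_wpM2r// sqr_ge0.
  have dd : d / (1 + d) < 1 by rewrite ltr_pdivrMr; lra.
  have t1 : 0 < 1 - t by lra.
  rewrite -[t]opprK expRN -[leRHS]invrK lef_pV2 ?posrE ?expR_gt0 ?invr_gt0//; last lra.
  apply: le_trans (expR_ge1Dx _).
  have -> : (1 + d)^-1 = 1 - d / (1 + d) by field; rewrite gt_eqF//; lra.
  by rewrite lerD2l lerN2 ltW.
have xg : vgrowth x r <= g.
  rewrite /vgrowth /g lerD2l ler_sqr ?nnegrE ?mulr_ge0 ?rnorm_ge0 ?(ltW r0) ?(ltW T0)//.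
  by rewrite ler_wpM2l ?(ltW r0)// lerDl.
pose mu : R[i] := Complex 1 r.
have mug : rnorm mu <= g.
  rewrite -ler_sqr ?nnegrE ?rnorm_ge0//; last lra.
  rewrite rnorm_sqr /= /g expr1n.
  have rT : r ^+ 2 <= (r * T) ^+ 2.
    rewrite ler_sqr ?nnegrE ?mulr_ge0 ?(ltW r0) ?(ltW T0)// ler_peMr ?(ltW r0)//.
    by rewrite lerDr rnorm_ge0.
  by have := sqr_ge0 ((r * T) ^+ 2); rewrite sqrrD expr1n; have := sqr_ge0 r; lra.
have oneg : rnorm (1 : R[i]) <= g by rewrite /rnorm normr1.
(* Bounds the norm (1 + g^N) / (1 + l) of [f], because [l >= 1]. *)
pose kappa := (1 + g ^+ N) / 2.
have gN1 : 1 <= g ^+ N by rewrite exprn_ege1.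
have k1 : 1 <= kappa by rewrite /kappa; lra.
have kd : kappa - 1 <= d by rewrite /kappa; lra.
have l0 : 0 < 1 + l by lra.
pose f := (- (1 + l)^-1)%:C *: vpow x r N.
have fE y : f ** y = (- (1 + l)^-1)%:C *: (iter N (vop x r) y - y).
  by rewrite /f -cscaleAl vpowM.
have fE1 y : f ** y - y = (- (1 + l)^-1)%:C *: (iter N (vop x r) y - mu ^+ N *: y).
  rewrite fE rl (_ : _ - (- l)%:C *: y = (iter N (vop x r) y - y) + (1 + l)%:C *: y).
    rewrite [RHS]scalerDr scalerA -rmorphM/= mulNr mulVf ?gt_eqF//; congr (_ + _).
    by rewrite rmorphN rmorph1 scaleN1r.
  by rewrite rmorphN scaleNr opprK rmorphD scalerDl scale1r addrA subrK.
have l2 : (1 + l)^-1 <= 2^-1 by rewrite lef_pV2 ?posrE//; lra.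
have li0 : 0 <= (1 + l)^-1 by rewrite invr_ge0 ltW.
have fnorm : rnorm f <= kappa.
  rewrite rnormZ rnorm_real normrN ger0_norm// /kappa mulrC; apply: ler_pM => //.
    exact: rnorm_ge0.
  apply: le_trans (rnorm_vpow _ _ xs) _; rewrite lerD2l lerXn2r ?nnegrE//; last lra.
  exact: le_trans ler01 (vgrowth_ge1 x r).
(* Used with [nu = mu] for [phi] and [nu = 1] for [psi]. The defect r e' is multiplied by N g^N,
   where N r <= 4 and g^N <= 2, and then at least halved by 1 / (1 + l). *)
have step (chi : A -> R[i]) (nu : R[i]) y : is_trace chi ->
    rnorm nu <= g -> hs chi (vop x r y - nu *: y) <= r * e' ->
    hs chi ((- (1 + l)^-1)%:C *: (iter N (vop x r) y - nu ^+ N *: y)) <= 4 * e'.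
  move=> chiT nug hy; rewrite (hsZ chiT) rnorm_real normrN ger0_norm//.
  have h : hs chi (iter N (vop x r) y - nu ^+ N *: y) <= 8 * e'.
    apply: le_trans (hs_iter_vop chiT _ _ xs xg nug) _.
    apply: (@le_trans _ _ (N%:R * 2 * (r * e'))).
      apply: ler_pM; rewrite ?hs_ge0 ?mulr_ge0 ?exprn_ge0//; first lra.
      by rewrite ler_wpM2l//; lra.
    have -> : N%:R * 2 * (r * e') = N%:R * r * (2 * e') by ring.
    have -> : 8 * e' = 4 * (2 * e') by ring.
    by rewrite ler_wpM2r// mulr_ge0// ltW.
  apply: (@le_trans _ _ (2^-1 * (8 * e'))); last by lra.
  by apply: ler_pM; rewrite ?hs_ge0.
have near_phi y : y \in s -> hs phi (f ** y - y) <= 4 * e'.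
  move=> ys; rewrite fE1; apply: step => //.
  have -> : vop x r y - mu *: y = Complex 0 r *: (x ** y - y).
    have -> : mu = 1 + Complex 0 r by apply: complex_eqP; rewrite /= ?addr0 ?add0r.
    by rewrite /vop scalerDl scale1r opprD addrACA subrr add0r scalerBr.
  rewrite (hsZ phiT) rnorm_imag gtr0_norm// ler_wpM2l ?(ltW r0)//.
  by have [] := xP _ ys.
have near_psi y : y \in s -> hs psi (f ** y) <= 4 * e'.
  move=> ys; rewrite fE -[X in _ - X]scale1r -[X in X *: y](expr1n _ N).
  apply: step => //.
  rewrite scale1r /vop [y + _]addrC addrK.
  rewrite (hsZ psiT) rnorm_imag gtr0_norm// ler_wpM2l ?(ltW r0)//.
  by have [] := xP _ ys.
exists (kappa^-1%:C *: f).
  rewrite rnormZ rnorm_real ger0_norm ?invr_ge0; last lra.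
  by rewrite mulrC ler_pdivrMr ?mul1r//; lra.
move=> y ys; rewrite -cscaleAl.
have k0 : 0 < kappa^-1 by rewrite invr_gt0; lra.
have k1' : kappa^-1 <= 1 by rewrite invf_le1//; lra.
split; last first.
  rewrite (hsZ psiT) rnorm_real gtr0_norm//.
  apply: le_trans (ler_wpM2r (hs_ge0 _ _) k1') _.
  by rewrite mul1r; apply: le_trans (near_psi _ ys) _; rewrite /e'; lra.
have -> : kappa^-1%:C *: (f ** y) - y =
    kappa^-1%:C *: (f ** y - y) + (kappa^-1 - 1)%:C *: y.
  by rewrite scalerBr rmorphB rmorph1 scalerBl scale1r addrA subrK.
apply: le_trans (hsD phiT _ _) _; rewrite !(hsZ phiT) !rnorm_real gtr0_norm//.
rewrite ler0_norm; last lra.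
have h1 : kappa^-1 * hs phi (f ** y - y) <= 4 * e'.
  by apply: le_trans (ler_wpM2r (hs_ge0 _ _) k1') _; rewrite mul1r near_phi.
have h2 : - (kappa^-1 - 1) * hs phi y <= e / 2.
  apply: le_trans dH; apply: ler_pM; rewrite ?hs_ge0 ?HP//; first lra.
  apply: le_trans kd; rewrite opprB.
  have -> : 1 - kappa^-1 = (kappa - 1) * kappa^-1 by field; rewrite gt_eqF//; lra.
  by rewrite ler_piMr//; lra.
by move: h1 h2; rewrite /e'; lra.
Qed.

End Contractions.

(** * Norms of traces and extremal tracial states *)

Section Extremal.
Variables (R : realType) (A : cstarAlgType R).
Implicit Types (phi psi theta tau rho : A -> R[i]) (a b x y f : A).

Lemma functional_norm_has_sup phi : is_trace phi ->
  has_sup [set rnorm (phi a) | a in [set a : A | rnorm a <= 1]].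
Proof.
move=> h; split; first by exists (rnorm (phi 0)); exists 0; rewrite //= rnorm0.
have [M M0 hM] := trace_bound h; exists M => _ [a /= a1 <-].
by apply: le_trans (hM a) _; rewrite ler_piMr.
Qed.

Lemma functional_norm_ub phi a : is_trace phi -> rnorm a <= 1 ->
  rnorm (phi a) <= functional_norm phi.
Proof. by move=> h a1; apply: ub_le_sup; [case: (functional_norm_has_sup h)|exists a]. Qed.

Lemma functional_norm_le phi (K : R) : is_trace phi ->
  (forall a, rnorm a <= 1 -> rnorm (phi a) <= K) -> functional_norm phi <= K.
Proof.
move=> h hK; apply: ge_sup; first by case: (functional_norm_has_sup h).
by move=> _ [a /= a1 <-]; exact: hK.
Qed.

Lemma functional_norm_ge0 phi : is_trace phi -> 0 <= functional_norm phi.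
Proof.
move=> h; apply: le_trans (rnorm_ge0 (phi 0)) _.
by apply: functional_norm_ub; rewrite ?rnorm0.
Qed.

Lemma rnorm_trace_le phi a : is_trace phi ->
  rnorm (phi a) <= functional_norm phi * rnorm a.
Proof.
move=> h; have [a0|a0] := leP (rnorm a) 0.
  have -> : a = 0 by apply: rnorm0_eq0; apply/le_anti; rewrite a0 rnorm_ge0.
  by rewrite (trace0 h) !rnorm0 mulr0.
rewrite -ler_pdivrMr// mulrC -[X in X * _]gtr0_norm ?invr_gt0// -rnorm_real -rnormCM.
rewrite -(traceZ h); apply: functional_norm_ub => //.
by rewrite rnormZ rnorm_real gtr0_norm ?invr_gt0// mulVf// gt_eqF.
Qed.

Lemma functional_norm_eq0 phi : is_trace phi -> functional_norm phi = 0 -> phi = fun=> 0.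
Proof.
move=> h h0; apply: funext => a; apply: rnorm0_eq0; apply/le_anti.
by rewrite rnorm_ge0 andbT; have := rnorm_trace_le a h; rewrite h0 mul0r.
Qed.

Lemma functional_normZ (t : R) phi : is_trace phi -> 0 <= t ->
  functional_norm (fun a => t%:C * phi a) = t * functional_norm phi.
Proof.
move=> h t0; have ht := is_traceZ t0 h.
have le (s : R) chi : is_trace chi -> 0 <= s ->
    functional_norm (fun a => s%:C * chi a) <= s * functional_norm chi.
  move=> hc s0; apply: functional_norm_le => [|a a1]; first exact: is_traceZ.
  by rewrite rnormCM rnorm_real ger0_norm// ler_wpM2l// functional_norm_ub.
apply/le_anti; rewrite le//=.
have [t_le0|tp] := leP t 0.
  by apply: le_trans (functional_norm_ge0 ht); rewrite mulr_le0_ge0// functional_norm_ge0.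
rewrite -ler_pdivlMl//; apply: le_trans (le t^-1 _ ht _); last by rewrite invr_ge0 ltW.
apply: functional_norm_le => // a a1.
have -> : phi a = t^-1%:C * (t%:C * phi a).
  by rewrite mulrA -rmorphM/= mulVf ?mul1r// gt_eqF.
by apply: functional_norm_ub => //; apply: is_traceZ => //; rewrite invr_ge0 ltW.
Qed.

Lemma trace_eq0_ip theta : is_trace theta -> (forall a, ip theta a a <= 0) ->
  forall a, theta a = 0.
Proof.
move=> h h0 a; have [M M0 hM] := trace_bound h.
have hs0 : hs theta a = 0 by apply/le_anti; rewrite hs_ge0 andbT /hs ler0_sqrtr.
apply: rnorm0_eq0; apply/le_anti; rewrite rnorm_ge0 andbT.
by have := trace_le_hs h M0 hM a; rewrite hs0 mulr0.
Qed.

Lemma disjoint_traces0 phi : disjoint_traces phi (fun=> 0).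
Proof. by move=> theta hT _ h0; apply: trace_eq0_ip. Qed.

(** With a unit both norms would be values at 1. Here [disjoint_contraction] against the zero trace
    gives one [f] almost acting as a unit for both traces, so that f^* f almost attains both norms
    at once. *)
Lemma functional_normD phi psi : is_trace phi -> is_trace psi ->
  functional_norm (fun a => phi a + psi a) = functional_norm phi + functional_norm psi.
Proof.
move=> h1 h2; have h12 := is_traceD h1 h2.
apply/le_anti/andP; split.
  apply: functional_norm_le => // a a1; apply: le_trans (rnormD _ _) _.
  by apply: lerD; exact: functional_norm_ub.
apply/ler_addgt0Pr => e e0; pose d := e / 8; have d0 : 0 < d by rewrite divr_gt0.
have [M M0 phiM] := trace_bound h1; have [N N0 psiN] := trace_bound h2.
pose C := (1 + expR 1) * Num.sqrt M; pose D := (1 + expR 1) * Num.sqrt N.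
have K0 : 0 <= 1 + expR 1 :> R by rewrite addr_ge0 ?expR_ge0.
have C0 : 0 <= C by rewrite mulr_ge0 ?sqrtr_ge0.
have D0 : 0 <= D by rewrite mulr_ge0 ?sqrtr_ge0.
have [_ [a /= a1 <-] ha] := sup_adherent d0 (functional_norm_has_sup h1).
have [_ [b /= b1 <-] hb] := sup_adherent d0 (functional_norm_has_sup h2).
have CD0 : 0 < C + D + 1 by lra.
pose d' := d / (C + D + 1); have d'0 : 0 < d' by rewrite divr_gt0.
have [f f1 fP] := disjoint_contraction [:: a; b] h12 (is_trace0 A) (@disjoint_traces0 _) d'0.
have key chi c (K : R) : is_trace chi -> 0 <= K -> K <= C + D + 1 ->
    (forall z, rnorm (chi z) <= K * hs chi z) -> rnorm c <= 1 ->
    functional_norm chi - d < rnorm (chi c) -> hs chi (f ** c - c) <= d' ->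
    functional_norm chi <= ip chi f f + 4 * d.
  move=> hc K0' KC chiK c1 cn fc.
  have n0 := functional_norm_ge0 hc.
  have e1 : rnorm (chi c) <= rnorm (chi (f ** c)) + d.
    have -> : chi c = chi (f ** c) - chi (f ** c - c) by rewrite (traceB hc) subKr.
    apply: le_trans (rnormD _ _) _; rewrite rnormN lerD2l.
    apply: le_trans (chiK _) _.
    have -> : d = (C + D + 1) * d' by rewrite /d'; field; rewrite gt_eqF.
    by apply: ler_pM; rewrite ?hs_ge0.
  have e2 : rnorm (chi (f ** c)) <= hs chi f * Num.sqrt (functional_norm chi).
    apply: le_trans (rnorm_mul_le hc _ _) _; rewrite ler_wpM2l ?hs_ge0//.
    apply: le_trans (hs_le_rnorm hc n0 _ c) _; first by move=> z; exact: rnorm_trace_le.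
    by rewrite ler_piMr// sqrtr_ge0.
  (* With N the norm of [chi], N - 2 d < hs f sqrt N <= (hs f ^2 + N) / 2. *)
  have := sqr_ge0 (hs chi f - Num.sqrt (functional_norm chi)).
  rewrite sqrrB (hs_sqr hc) sqr_sqrtr//; lra.
have k1 : functional_norm phi <= ip phi f f + 4 * d.
  apply: (key _ a C) => //; first lra.
  - exact: trace_le_hs.
  - apply: le_trans (dominated_hs _ (dominatedDl _ h2)) _.
    by have [] := fP a; rewrite ?inE ?eqxx.
have k2 : functional_norm psi <= ip psi f f + 4 * d.
  apply: (key _ b D) => //; first lra.
  - exact: trace_le_hs.
  - apply: le_trans (dominated_hs _ (dominatedDr _ h1)) _.
    by have [] := fP b; rewrite ?inE ?eqxx ?orbT.
have : ip phi f f + ip psi f f <= functional_norm (fun a => phi a + psi a).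
  rewrite -ip_traceD; apply: le_trans (le_trans (ler_norm _) (Re_le_rnorm _)) _.
  apply: functional_norm_ub => //; rewrite rnorm_star2.
  by rewrite expr_le1// rnorm_ge0.
by move: k1 k2; rewrite /d; lra.
Qed.

(** If the norm [n] of [theta] lies strictly between 0 and 1, [tau] is a convex combination of the
    normalised [theta] and [tau - theta], with weights [n] and [1 - n] by [functional_normD].
    Otherwise one of the two summands is zero. *)
Lemma extremal_dominated tau theta : extremal_tracial_state tau -> is_trace theta ->
  dominated theta tau -> forall a, theta a = (functional_norm theta)%:C * tau a.
Proof.
move=> [[tauT tau1] ext] thT d a.
have rT := is_traceB tauT thT d.
set n := functional_norm theta; have n0 : 0 <= n := functional_norm_ge0 thT.
have nE : n + functional_norm (fun a => tau a - theta a) = 1.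
  rewrite -functional_normD// -tau1; congr functional_norm.
  by apply: funext => b; rewrite addrC subrK.
have rE : functional_norm (fun a => tau a - theta a) = 1 - n by lra.
have r0 := functional_norm_ge0 rT.
have [z|npos] := leP n 0.
  have n00 : n = 0 by apply/le_anti; rewrite z n0.
  by rewrite n00 mul0r (functional_norm_eq0 thT n00).
have [z|nlt1] := leP 1 n.
  have n11 : n = 1 by lra.
  have := functional_norm_eq0 rT; rewrite rE n11 subrr => /(_ erefl)/(congr1 (@^~ a))/eqP.
  by rewrite subr_eq0 mul1r => /eqP.
have m0 : 0 < 1 - n by lra.
have [||||h1 _] := ext (fun a => n^-1%:C * theta a)
    (fun a => (1 - n)^-1%:C * (tau a - theta a)) n.
- split; first by apply: is_traceZ; rewrite ?invr_ge0.
  by rewrite functional_normZ ?invr_ge0// mulVf// gt_eqF.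
- split; first by apply: is_traceZ; rewrite ?invr_ge0// ltW.
  by rewrite functional_normZ ?invr_ge0 ?(ltW m0)// rE mulVf// gt_eqF.
- by rewrite npos nlt1.
- apply: funext => b; rewrite !mulrA -!rmorphM/= !divff ?gt_eqF//.
  by rewrite !mul1r addrC subrK.
by rewrite -h1 mulrA -rmorphM/= divff ?mul1r// gt_eqF.
Qed.

(** A common minorant is its norm times either state, so a nonzero one would identify the two. *)
Lemma extremal_disjoint tau1 tau2 : extremal_tracial_state tau1 ->
  extremal_tracial_state tau2 -> tau1 <> tau2 -> disjoint_traces tau1 tau2.
Proof.
move=> e1 e2 ne theta thT d1 d2.
have h1 := extremal_dominated e1 thT d1; have h2 := extremal_dominated e2 thT d2.
have [n0|n0] := eqVneq (functional_norm theta) 0.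
  by move=> a; rewrite h1 n0 mul0r.
exfalso; apply: ne; apply: funext => a; apply: (@mulfI _ (functional_norm theta)%:C).
  by apply/eqP => -[] /eqP; exact/negP.
by rewrite -h1 h2.
Qed.

(** A common minorant [theta] is disjoint from each [phi_i]. Contractions [g], then [f], almost fix
    [y] for [theta] while making it small for [phi2], then [phi1]; but [theta] is below their
    sum. *)
Lemma disjoint_tracesD phi1 phi2 psi : is_trace phi1 -> is_trace phi2 ->
  disjoint_traces phi1 psi -> disjoint_traces phi2 psi ->
  disjoint_traces (fun a => phi1 a + phi2 a) psi.
Proof.
move=> h1 h2 d1 d2 theta thT t12 tpsi; apply: trace_eq0_ip => // y.
have td1 : disjoint_traces theta phi1 := disjoint_traces_dominated tpsi (disjoint_traces_sym d1).
have td2 : disjoint_traces theta phi2 := disjoint_traces_dominated tpsi (disjoint_traces_sym d2).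
suff : hs theta y <= 0 by rewrite -(hs_sqr thT) => hy; have := hs_ge0 theta y; nra.
apply/ler_addgt0Pr => e e0; rewrite add0r.
have d0 : 0 < e / 4 by rewrite divr_gt0.
have [g g1 /(_ y)] := disjoint_contraction [:: y] thT h2 td2 d0.
rewrite inE eqxx => -[//|gt g2].
have [f f1 /(_ (g ** y))] := disjoint_contraction [:: g ** y] thT h1 td1 d0.
rewrite inE eqxx => -[//|ft f2].
have k2 : hs phi2 (f ** (g ** y)) <= e / 4.
  apply: le_trans (hs_mull h2 _ _) _; apply: le_trans g2.
  by rewrite ler_piMl ?hs_ge0.
have k : hs theta (f ** (g ** y)) <= e / 2.
  rewrite -ler_sqr ?nnegrE ?hs_ge0 ?divr_ge0 ?(ltW e0)// (hs_sqr thT).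
  apply: le_trans (t12 _) _; rewrite ip_traceD -(hs_sqr h1) -(hs_sqr h2).
  have := hs_ge0 phi1 (f ** (g ** y)); have := hs_ge0 phi2 (f ** (g ** y)); nra.
have -> : y = f ** (g ** y) - (f ** (g ** y) - g ** y) - (g ** y - y).
  by rewrite subKr subKr.
apply: le_trans (hsB thT _ _) _; have := hsB thT (f ** (g ** y)) (f ** (g ** y) - g ** y).
lra.
Qed.

(** [c] is the largest multiple of [tau] below [rho]. By extremality a minorant of [tau] is some
    [n * tau]; if it also lies below the remainder, maximality forces [n = 0]. *)
Lemma remove_multiple tau rho : extremal_tracial_state tau -> is_trace rho ->
  exists c : R, [/\ 0 <= c, is_trace (fun a => rho a - c%:C * tau a) &
    disjoint_traces tau (fun a => rho a - c%:C * tau a)].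
Proof.
move=> ext rT; have [[tauT tau1] _] := ext.
have [y y0] : exists y, 0 < ip tau y y.
  apply: contrapT => /forallNP h; have : functional_norm tau = 0.
    have -> : tau = fun=> 0.
      apply: funext => a; apply: trace_eq0_ip => // z.
      by rewrite leNgt; apply/negP; exact: h.
    apply/le_anti; rewrite functional_norm_ge0 ?andbT; last exact: is_trace0.
    by apply: functional_norm_le; [exact: is_trace0|move=> z _; rewrite rnorm0].
  by rewrite tau1 => /eqP; rewrite oner_eq0.
have ipZ (c : R) z : ip (fun a => c%:C * tau a) z z = c * ip tau z z.
  by rewrite /ip cReM /= mul0r subr0.
pose S := [set c : R | 0 <= c /\ forall z, c * ip tau z z <= ip rho z z].
have S0 : S 0 by split=> // z; rewrite mul0r ip_ge0.
have ubS : has_sup S.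
  split; first by exists 0.
  by exists (ip rho y y / ip tau y y) => c [_ /(_ y)]; rewrite ler_pdivlMr.
pose c := sup S; have c0 : 0 <= c by apply: ub_le_sup => //; case: ubS.
have dc z : c * ip tau z z <= ip rho z z.
  have [z_le0|z0] := leP (ip tau z z) 0.
    by apply: le_trans (ip_ge0 rT z); rewrite mulr_ge0_le0.
  rewrite -ler_pdivlMr//; apply: ge_sup; first by case: ubS.
  by move=> k [_ /(_ z)]; rewrite ler_pdivlMr.
have cT := is_traceZ c0 tauT.
have sT : is_trace (fun a => rho a - c%:C * tau a).
  by apply: is_traceB => // z; rewrite ipZ.
exists c; split=> // theta thT d1 d2.
have thE := extremal_dominated ext thT d1; set n := functional_norm theta in thE.
have n0 : 0 <= n := functional_norm_ge0 thT.
suff nle : n <= 0.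
  have n00 : n = 0 by apply/le_anti; rewrite nle n0.
  by move=> a; rewrite thE n00 mul0r.
have Scn : S (c + n).
  split; first by rewrite addr_ge0.
  move=> z; have := d2 z; have -> : ip theta z z = n * ip tau z z.
    by rewrite -ipZ /ip thE.
  have -> : ip (fun a => rho a - c%:C * tau a) z z = ip rho z z - c * ip tau z z.
    by rewrite -ipZ /ip cReD cReN.
  by rewrite mulrDl; lra.
have : c + n <= c by apply: ub_le_sup => //; case: ubS.
by lra.
Qed.

End Extremal.

(** * Finite families of traces and the greedy decomposition *)

Section Families.
Variables (R : realType) (A : cstarAlgType R).
Implicit Types (tau : nat -> A -> R[i]) (psi rho : A -> R[i]) (s : seq nat).

Definition trace_sum tau s a : R[i] := \sum_(k <- s) tau k a.

Lemma trace_sum_nil tau : trace_sum tau [::] = fun=> 0.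
Proof. by apply: funext => a; rewrite /trace_sum big_nil. Qed.

Lemma trace_sum_cons tau k s : trace_sum tau (k :: s) = fun a => tau k a + trace_sum tau s a.
Proof. by apply: funext => a; rewrite /trace_sum big_cons. Qed.

Lemma is_trace_sum tau s : (forall k, is_trace (tau k)) -> is_trace (trace_sum tau s).
Proof.
move=> h; elim: s => [|k s IH]; first by rewrite trace_sum_nil; exact: is_trace0.
by rewrite trace_sum_cons; exact: is_traceD.
Qed.

Lemma dominated_trace_sum tau s k : (forall k, is_trace (tau k)) -> k \in s ->
  dominated (tau k) (trace_sum tau s).
Proof.
move=> h; elim: s => //= j s IH; rewrite inE trace_sum_cons => /predU1P[->|/IH d] a.
  exact/dominatedDl/is_trace_sum.
exact: le_trans (d a) (dominatedDr _ (h j) a).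
Qed.

Lemma disjoint_trace_sum tau s psi : (forall k, is_trace (tau k)) ->
  (forall k, k \in s -> disjoint_traces (tau k) psi) -> disjoint_traces (trace_sum tau s) psi.
Proof.
move=> h; elim: s => [|k s IH] d.
  by rewrite trace_sum_nil; exact/disjoint_traces_sym/disjoint_traces0.
rewrite trace_sum_cons; apply: disjoint_tracesD => //; first exact: is_trace_sum.
  by apply: d; rewrite inE eqxx.
by apply: IH => j js; apply: d; rewrite inE js orbT.
Qed.

(** [w = f ** g], where [g] is an approximate unit for the whole family, with
    [hs (tau k) g >= 1 / 2], and [f] almost fixes [g] for the family and kills it for [psi]. At
    least 1 / 4 of the seminorm survives, hence the square 1 / 16. *)
Lemma separating_contraction tau s psi (e : R) : (forall k, tracial_state (tau k)) ->
  is_trace psi -> disjoint_traces (trace_sum tau s) psi -> 0 < e ->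
  exists w : A, [/\ rnorm w <= 1, forall k, k \in s -> 1 / 16 <= ip (tau k) w w &
    ip psi w w <= e].
Proof.
move=> st psiT dis e0; have tT k : is_trace (tau k) by case: (st k).
have sT := is_trace_sum s tT.
have /choice[y yP] : forall k, exists y : A, rnorm y <= 1 /\ 3 / 4 < rnorm (tau k y).
  move=> k; have q0 : 0 < 1 / 4 :> R by lra.
  have [_ [y /= y1 <-] hy] := sup_adherent q0 (functional_norm_has_sup (tT k)).
  exists y; split=> //; move: hy; have [_] := st k; rewrite /functional_norm => ->; lra.
set K : R := 1 + expR 1; have K0 : 0 < K by rewrite addr_gt0 ?expR_gt0.
have tau_le1 k a : rnorm (tau k a) <= 1 * rnorm a.
  by have [_ n1] := st k; have := rnorm_trace_le a (tT k); rewrite n1.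
have tauK k a : rnorm (tau k a) <= K * hs (tau k) a.
  have := trace_le_hs (tT k) ler01 (tau_le1 k) a.
  by rewrite sqrtr1 mulr1.
have hs1 k a : rnorm a <= 1 -> hs (tau k) a <= 1.
  move=> a1; have := hs_le_rnorm (tT k) ler01 (tau_le1 k) a.
  by rewrite sqrtr1 mul1r => h; exact: le_trans h a1.
have d0 : 0 < (4 * K)^-1 by rewrite invr_gt0 mulr_gt0.
have [g g1 gP] := disjoint_contraction [seq y k | k <- s] sT (is_trace0 A)
  (@disjoint_traces0 _ _ _) d0.
have ghalf k : k \in s -> 1 / 2 <= hs (tau k) g.
  move=> ks; have [y1 y2] := yP k.
  have [gy _] := gP _ (map_f y ks).
  have h1 : rnorm (tau k (g ** y k - y k)) <= 1 / 4.
    apply: le_trans (tauK _ _) _; have -> : 1 / 4 = K * (4 * K)^-1 :> R by field; rewrite gt_eqF.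
    rewrite ler_pM2l//; apply: le_trans gy; apply: dominated_hs.
    exact: dominated_trace_sum.
  have h2 : rnorm (tau k (y k)) <= rnorm (tau k (g ** y k)) + 1 / 4.
    have -> : tau k (y k) = tau k (g ** y k) - tau k (g ** y k - y k).
      by rewrite (traceB (tT k)) subKr.
    by apply: le_trans (rnormD _ _) _; rewrite rnormN lerD2l.
  have h3 : rnorm (tau k (g ** y k)) <= hs (tau k) g.
    apply: le_trans (rnorm_mul_le (tT k) _ _) _.
    by rewrite ler_piMr ?hs_ge0 ?hs1.
  by lra.
have e1 : 0 < Num.min (1 / 4) (Num.sqrt e) by rewrite lt_min sqrtr_gt0 e0 andbT; lra.
have [f f1 /(_ g)] := disjoint_contraction [:: g] sT psiT dis e1.
rewrite inE eqxx => -[//|]; rewrite !le_min => /andP[fphi _] /andP[_ fpsi].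
exists (f ** g); split.
- apply: le_trans (rnormM _ _) _; rewrite -[leRHS]mul1r.
  by apply: ler_pM; rewrite ?rnorm_ge0.
- move=> k ks; have h1 := ghalf k ks.
  have h2 : hs (tau k) (f ** g - g) <= 1 / 4.
    by apply: le_trans fphi; apply: dominated_hs; exact: dominated_trace_sum.
  have h3 : hs (tau k) g <= hs (tau k) (f ** g) + hs (tau k) (f ** g - g).
    by rewrite -{1}(subKr (f ** g) g) hsB.
  have h4 : 1 / 4 <= hs (tau k) (f ** g) by lra.
  have -> : 1 / 16 = (1 / 4) ^+ 2 :> R by field.
  by rewrite -(hs_sqr (tT k)) ler_sqr ?nnegrE ?hs_ge0//; lra.
- rewrite -(hs_sqr psiT) -[leRHS]sqr_sqrtr ?(ltW e0)//.
  by rewrite ler_sqr ?nnegrE ?hs_ge0 ?sqrtr_ge0.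
Qed.

(** Iterates [remove_multiple]. The remainders decrease, so disjointness from an already treated
    [tau k] persists. *)
Lemma greedy_decomposition tau rho : (forall k, extremal_tracial_state (tau k)) ->
  is_trace rho -> exists (c : nat -> R) (r : nat -> A -> R[i]),
  [/\ forall k, 0 <= c k, forall m, is_trace (r m),
    forall m k, (k < m)%N -> disjoint_traces (tau k) (r m) &
    forall m w, ip rho w w = \sum_(k < m) c k * ip (tau k) w w + ip (r m) w w].
Proof.
move=> ext rT; have tT k : is_trace (tau k) by case: (ext k) => -[].
(* Choosing a coefficient for every functional, with the default 0 off traces, keeps the recursion
   for [r] free of proofs. *)
have /choice[C CP] : forall p : (A -> R[i]) * nat, exists c : R, is_trace p.1 ->
    [/\ 0 <= c, is_trace (fun a => p.1 a - c%:C * tau p.2 a) &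
      disjoint_traces (tau p.2) (fun a => p.1 a - c%:C * tau p.2 a)].
  move=> [chi k] /=; have [chiT|nT] := pselect (is_trace chi); last by exists 0.
  by have [c h] := remove_multiple (ext k) chiT; exists c.
pose r := fix r m := if m is k.+1 then fun a => r k a - (C (r k, k))%:C * tau k a else rho.
have rmT m : is_trace (r m) by elim: m => // m IH; have [] := CP (r m, m) IH.
pose c k := C (r k, k).
have c0 k : 0 <= c k by have [] := CP (r k, k) (rmT k).
have ipr m w : ip (r m) w w = c m * ip (tau m) w w + ip (r m.+1) w w.
  by rewrite /ip /= cReD cReN cReM /= mul0r subr0 addrC subrK.
exists c, r; split=> // m.
  move=> k km; apply: disjoint_traces_sym.
  have [_ _ d] := CP (r k, k) (rmT k); move: d => /disjoint_traces_sym.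
  apply: disjoint_traces_dominated; rewrite -/(r k.+1).
  elim: m km => // m IH; rewrite ltnS leq_eqVlt => /predU1P[->//|/IH d] a.
  by apply: le_trans (d a); rewrite (ipr m) lerDr mulr_ge0// ip_ge0.
move=> w; elim: m => [|m IH]; first by rewrite big_ord0 add0r.
by rewrite big_ord_recr/= -addrA -ipr.
Qed.

End Families.

(** * Traces on the ultrapower *)

Section UltrapowerTraces.
Variables (R : realType) (U : set_system nat) (UU : UltraFilter U).

Lemma is_trace_clim (B : cstarAlgType R) (t : nat -> B -> R[i]) (M : R) :
  (forall k, is_trace (t k)) -> (forall k a, rnorm (t k a) <= M * rnorm a) ->
  is_trace (fun a => clim U (fun k => t k a)).
Proof.
move=> tT tM; have cb a : cbounded (fun k => t k a) by exists (M * rnorm a).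
split.
- move=> k a b; rewrite -clim_linear//; congr (clim U _).
  by apply: funext => n; rewrite (trace_linear (tT n)).
- exists (M + M) => a; rewrite mulrDl.
  by apply: (rnorm_clim_le (cb a) (fun n => tM n a)); exact: cvg_cst.
- by move=> a; apply: clim_ge0 => // k; exact: trace_positive (tT k) a.
- by move=> a b; congr (clim U _); apply: funext => n; rewrite (trace_comm (tT n)).
Qed.

Variable A : cstarAlgType R.

(** The ultralimit of the constant sequence [t]; [ultratrace_uclass] gives independence of the
    representative. *)
Definition ultratrace (t : A -> R[i]) (x : ultrapower A UU) : R[i] :=
  clim U (fun n => t (urepr x n)).

Variable t : A -> R[i].
Hypothesis tT : is_trace t.
Variable M : R.
Hypothesis M0 : 0 <= M.
Hypothesis tM : forall a, rnorm (t a) <= M * rnorm a.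

Lemma linf_cbounded (a : linf A) : cbounded (fun n => t (a n)).
Proof.
have [N aN] := linfP a; exists (M * N) => n.
by apply: le_trans (tM _) _; rewrite ler_wpM2l.
Qed.

Lemma ultratrace_uclass (a : linf A) :
  ultratrace t (uclass UU a) = clim U (fun n => t (a n)).
Proof.
rewrite /ultratrace; set b := urepr _.
have /asboolP ba : b - a \in cU U := urepr_uclass UU a.
have -> : (fun n => t (b n)) = (fun n => 1 * t ((b - a) n) + t (a n)).
  by apply: funext => n; rewrite mul1r -(traceD tT) subrK.
rewrite clim_linear; try exact: linf_cbounded.
rewrite mul1r [X in X + _](_ : _ = 0) ?add0r//.
apply: (@clim_eq _ U _ _ _ (fun n => M * rnorm ((b - a) n))).
  by move=> n; rewrite subr0.
by rewrite -[X in _ --> X](mulr0 M); apply: cvgM => //; exact: cvg_cst.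
Qed.

Lemma uclassM (a b : linf A) : uclass UU a ** uclass UU b = uclass UU (linf_mul a b).
Proof. exact: umulE. Qed.

Lemma uclass_star (a : linf A) : star (uclass UU a) = uclass UU (linf_star a).
Proof. exact: ustarE. Qed.

Lemma rnorm_ultratrace x : rnorm (ultratrace t x) <= (M + M) * rnorm x.
Proof.
elim/uclassW: x => a; rewrite ultratrace_uclass mulrDl.
apply: (rnorm_clim_le (linf_cbounded a) (fun n => tM (a n))).
by apply: cvgM; [exact: cvg_cst|exact: unorm_cvg].
Qed.

Lemma is_trace_ultratrace : is_trace (ultratrace t).
Proof.
split.
- move=> k; elim/uclassW => a; elim/uclassW => b.
  rewrite -uclassZ -uclassD !ultratrace_uclass -clim_linear; try exact: linf_cbounded.
  by congr (clim U _); apply: funext => n; rewrite -(trace_linear tT).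
- by exists (M + M); exact: rnorm_ultratrace.
- elim/uclassW => a; rewrite uclass_star uclassM ultratrace_uclass.
  by apply: clim_ge0; [exact: linf_cbounded|move=> n; exact: trace_positive tT _].
- elim/uclassW => a; elim/uclassW => b; rewrite !uclassM !ultratrace_uclass.
  by congr (clim U _); apply: funext => n /=; rewrite (trace_comm tT).
Qed.

End UltrapowerTraces.

(** * The iterated limit is not an ultralimit *)

Section NotUltralimit.

(** If a singleton {k} lay in [U], every member of [U] would contain k, and maximality would make
    [U] principal. *)
Lemma nonprincipal_eventually (U : set_system nat) (UU : UltraFilter U) :
  (forall n : nat, U <> principal_filter n) -> \oo `<=` U.
Proof.
move=> np; have Uk k : U [set~ k].
  have [Uk|//] := in_ultra_setVsetC [set k] UU.
  exfalso; apply: (np k); apply/esym; apply: max_filter; first exact: principal_filter_proper.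
  move=> S US; apply/principal_filterP.
  have [j [Sj jk]] : exists j, (S `&` [set k]) j by apply: (@filter_ex _ U); exact: filterI.
  by rewrite -jk.
have Uge N : U [set n | (N <= n)%N].
  elim: N => [|N IH]; first by apply: filterE.
  apply: filterS2 IH (Uk N) => n /= Nn nN; rewrite ltn_neqAle Nn andbT eq_sym.
  exact/eqP.
by move=> S [N _ NS]; apply: filterS (Uge N).
Qed.

Variables (R : realType) (A : cstarAlgType R) (U : set_system nat).
Variable UU : UltraFilter U.
Hypothesis Uoo : \oo `<=` U.
Variable tau : nat -> A -> R[i].
Hypothesis ext : forall k, extremal_tracial_state (tau k).
Hypothesis tau_inj : injective tau.

Let tauS k : tracial_state (tau k). Proof. by case: (ext k). Qed.
Let tauT k : is_trace (tau k). Proof. by case: (tauS k). Qed.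
Let tau1 k a : rnorm (tau k a) <= 1 * rnorm a.
Proof. by have [_ n1] := tauS k; have := rnorm_trace_le a (tauT k); rewrite n1. Qed.

Let sigma (x : ultrapower A UU) : R[i] := clim U (fun k => ultratrace (tau k) x).

Lemma iterated_limit_trace : is_trace sigma.
Proof.
apply: (@is_trace_clim _ _ _ _ _ (1 + 1)) => k.
  exact: (is_trace_ultratrace UU (tauT k) ler01 (tau1 k)).
by move=> x; exact: (rnorm_ultratrace (tauT k) ler01 (tau1 k)).
Qed.

Variable rho : nat -> A -> R[i].
Hypothesis rho_lim : is_ultralimit rho sigma.

Let harmonic_cvg : n.+1%:R^-1 @[n --> U] --> (0 : R).
Proof. by move=> S /(@cvg_harmonic R); exact: Uoo. Qed.

Let near_gt N : \forall n \near U, (N < n)%N.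
Proof. by apply: Uoo; exists N.+1. Qed.

(** Evaluates [sigma] and the [rho n] at the class of w^* w. This is the only way in which the two
    are compared below. *)
Lemma contraction_limits (w : nat -> A) : (forall n, rnorm (w n) <= 1) ->
  exists (l : nat -> R) (L : R),
  [/\ forall k, ip (tau k) (w n) (w n) @[n --> U] --> l k,
    l k @[k --> U] --> L & ip (rho n) (w n) (w n) @[n --> U] --> L].
Proof.
move=> w1; have wb : w \in @norm_bounded R A by apply/asboolP; exists 1.
pose a := Linf wb; pose p := linf_mul (linf_star a) a.
have cb k : cbounded (fun n => tau k (p n)) := linf_cbounded ler01 (tau1 k) p.
have utE k : ultratrace (tau k) (uclass UU p) = clim U (fun n => tau k (p n)).
  exact: (ultratrace_uclass UU (tauT k) ler01 (tau1 k)).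
exists (fun k => complex.Re (ultratrace (tau k) (uclass UU p))).
exists (complex.Re (sigma (uclass UU p))); split.
- by move=> k; rewrite utE; exact: clim_Re.
- apply: clim_Re; exists ((1 + 1) * rnorm (uclass UU p)) => k.
  exact: (rnorm_ultratrace (tauT k) ler01 (tau1 k)).
- apply/cvgrPdist_le => e e0; have e0C : 0 < e%:C by rewrite ltcR.
  have cv : rho n (p n) @[n --> U] --> sigma (uclass UU p) by exact: rho_lim.
  have near1 : \forall n \near U, `|sigma (uclass UU p) - rho n (p n)| <= e%:C.
    by move/cvgrPdist_le: cv; apply.
  apply: filterS near1 => n.
  by rewrite rnorm_le /ip -cReN -cReD; apply: le_trans; exact: Re_le_rnorm.
Qed.

Variables (c : nat -> nat -> R) (r : nat -> nat -> A -> R[i]).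
Hypothesis c_ge0 : forall n k, 0 <= c n k.
Hypothesis rT : forall n m, is_trace (r n m).
Hypothesis r_disjoint : forall n m k, (k < m)%N -> disjoint_traces (tau k) (r n m).
Hypothesis rho_split : forall n m w,
  ip (rho n) w w = \sum_(k < m) c n k * ip (tau k) w w + ip (r n m) w w.

(** [ip (rho n) (w n) (w n)] is at least [c n k / 16], and it tends to 0: the inner limits at j != k
    vanish and the outer limit ignores the single index k. *)
Lemma coefficient_cvg0 k : c n k @[n --> U] --> 0.
Proof.
pose s n := [seq j <- iota 0 n | j != k].
have /choice[w wP] : forall n, exists w : A, [/\ rnorm w <= 1,
    forall j, j \in [:: k] -> 1 / 16 <= ip (tau j) w w &
    ip (trace_sum tau (s n)) w w <= n.+1%:R^-1].
  move=> n; apply: separating_contraction => //; first exact: is_trace_sum.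
  apply: disjoint_trace_sum => // _ /[!inE]/eqP->.
  apply: disjoint_traces_sym; apply: disjoint_trace_sum => // j.
  rewrite mem_filter => /andP[jk _]; apply: extremal_disjoint => //.
  by move/tau_inj; exact/eqP.
have w1 n : rnorm (w n) <= 1 by case: (wP n).
have [l [L [lP LP rhoL]]] := contraction_limits w1.
have l0 j : j != k -> l j = 0.
  move=> jk; rewrite -(ulim_eq (lP j)); apply: ulim_eq.
  apply: (@squeeze_cvgr _ _ _ _ (fun=> 0) (fun n => n.+1%:R^-1)) => //; last exact: cvg_cst.
  apply: filterS (near_gt j) => n jn; rewrite ip_ge0//=.
  have [_ _] := wP n; apply: le_trans; apply: dominated_trace_sum => //.
  by rewrite mem_filter jk mem_iota.
have L0 : L = 0.
  rewrite -(ulim_eq LP); apply: ulim_eq; apply: cvg_near_cst.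
  by apply: filterS (near_gt k) => j kj; apply: l0; rewrite gtn_eqF.
rewrite L0 in rhoL.
apply: (@squeeze_cvgr _ _ _ _ (fun=> 0) (fun n => 16 * ip (rho n) (w n) (w n))).
- apply: filterE => n; rewrite c_ge0/= (rho_split n k.+1) big_ord_recr/=.
  have [_ /(_ k)] := wP n; rewrite inE eqxx => /(_ isT) hk _.
  have h1 : 0 <= \sum_(i < k) c n i * ip (tau i) (w n) (w n).
    by apply: sumr_ge0 => i _; rewrite mulr_ge0// ip_ge0.
  have h2 := ip_ge0 (rT n k.+1) (w n).
  have := ler_wpM2l (c_ge0 n k) hk; lra.
- exact: cvg_cst.
- by rewrite -[X in _ --> X](mulr0 16); apply: cvgM => //; exact: cvg_cst.
Qed.

Lemma iterated_limit_contradiction : False.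
Proof.
have sum0 m : \sum_(k < m) c n k @[n --> U] --> 0.
  elim: m => [|m IH].
    by apply: cvg_near_cst; apply: filterE => n; rewrite big_ord0.
  have -> : (fun n => \sum_(k < m.+1) c n k) = (fun n => \sum_(k < m) c n k + c n m).
    by apply: funext => n; rewrite big_ord_recr.
  by rewrite -[X in _ --> X]addr0; apply: cvgD => //; exact: coefficient_cvg0.
(* Diagonal choice: [mm n] is the largest m <= n whose coefficient sum is at most 1 / (m + 1). It
   exists since m = 0 qualifies, and it tends to infinity along [U] by [sum0]. *)
pose good n (m : nat) := \sum_(k < m) c n k <= m.+1%:R^-1.
pose mm n := (\max_(m < n.+1 | good n m) m)%N.
have mm_good n : good n (mm n).
  have [|i gi mE] := @eq_bigmax_cond 'I_n.+1 [pred m | good n (nat_of_ord m)] val.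
    by apply/card_gt0P; exists ord0; rewrite inE /good/= big_ord0 invr1.
  by have -> : mm n = val i := mE.
have mm_near m : \forall n \near U, (m <= mm n)%N.
  have p0 : 0 < m.+1%:R^-1 :> R by rewrite invr_gt0.
  have near1 : \forall n \near U, \sum_(k < m) c n k < m.+1%:R^-1.
    exact: (@cvgr_lt _ _ _ _ _ _ (sum0 m)).
  apply: filterS2 near1 (near_gt m) => n gn mn.
  have mn1 : (m < n.+1)%N by rewrite ltnS ltnW.
  exact: (@leq_bigmax_cond _ [pred m | good n (nat_of_ord m)] val (Ordinal mn1) (ltW gn)).
have /choice[w wP] : forall n, exists w : A, [/\ rnorm w <= 1,
    forall j, j \in iota 0 (mm n) -> 1 / 16 <= ip (tau j) w w &
    ip (r n (mm n)) w w <= n.+1%:R^-1].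
  move=> n; apply: separating_contraction => //.
  apply: disjoint_trace_sum => // j; rewrite mem_iota => /andP[_ jm].
  exact: r_disjoint.
have w1 n : rnorm (w n) <= 1 by case: (wP n).
have [l [L [lP LP rhoL]]] := contraction_limits w1.
have l16 k : 1 / 16 <= l k.
  apply: (cvg_le_near (cvg_cst (1 / 16 : R)) (lP k)).
  apply: filterS (mm_near k.+1) => n kn; have [_ + _] := wP n; apply.
  by rewrite mem_iota.
have L16 : 1 / 16 <= L.
  by apply: (cvg_le_near (cvg_cst (1 / 16 : R)) LP); apply: filterE => k.
have ip1 k n : ip (tau k) (w n) (w n) <= 1.
  apply: le_trans (le_trans (ler_norm _) (Re_le_rnorm _)) _.
  by apply: le_trans (tau1 _ _) _; rewrite mul1r rnorm_star2 expr_le1 ?rnorm_ge0.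
(* Once [mm n >= 31], the coefficient sum is at most 1 / 32 and the remainder at most 1 / (n + 1),
   against the lower bound 1 / 16. *)
have : L <= 32^-1 + 0.
  apply: (cvg_le_near rhoL (cvgD (cvg_cst (32^-1 : R)) harmonic_cvg)).
  apply: filterS (mm_near 31) => n mn; rewrite (rho_split n (mm n)).
  have [_ _ hr] := wP n; apply: lerD => //.
  apply: le_trans (le_trans (mm_good n) _); last by rewrite lef_pV2 ?posrE// ler_nat.
  by apply: ler_sum => k _; rewrite ler_piMr.
by move: L16; lra.
Qed.

End NotUltralimit.

End TracesOnUltrapowers.

Theorem theorem1p1 (R : realType) (U : set_system nat) (UU : UltraFilter U)
    (U_nonprincipal : forall n : nat, U <> principal_filter n)
    (A : cstarAlgType R)
    (A_infinite : infinite_set [set tau : A -> R[i] | extremal_tracial_state tau]) :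
  exists tau : ultrapower A UU -> R[i],
    is_trace tau /\ ~ ultralimit_of_traces tau.
Proof.
have /infiniteP/pcard_leP[f] := A_infinite.
have ext k : extremal_tracial_state (f k) by exact: (@funS _ _ _ _ f k I).
have f_inj : injective f by move=> j k /inj; apply; rewrite inE.
have Uoo := nonprincipal_eventually UU U_nonprincipal.
exists (fun x => clim U (fun k => ultratrace (f k) x)); split.
  exact: iterated_limit_trace.
move=> [rho [rhoT _ rho_lim]].
have /choice[c /choice[r crP]] := fun n => greedy_decomposition ext (rhoT n).
by apply: (@iterated_limit_contradiction _ _ _ UU Uoo f ext f_inj rho rho_lim c r);
  move=> n; have [] := crP n.
Qed.
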